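(* There is an absolute constant $c>0$ such that the following holds for all positive integers $k$ and $\ell$, every graph $G$ and every subset $S\subseteq V(G)$. At least one of the following is true: (a) there exist $k$ pairwise vertex-disjoint $S$-cycles in $G$, each of length at least $\ell$; or (b) there is a set $X\subseteq V(G)$ with $|X|\le c\cdot \ell\cdot k\log k$ such that $G-X$ does not contain any $S$-cycle of length at least $\ell$. (That is, in (b), $|X|=O(\ell\cdot k\log k)$.)
   Context: Graphs are finite, simple and undirected. For a vertex set $S\subseteq V(G)$, an $S$-cycle is a cycle of $G$ that contains at least one vertex of $S$. The length of a cycle is its number of edges. $G-X$ is the graph obtained from $G$ by deleting the vertices of $X$. The logarithm is to base $2$. *)

(* Defs.v *)
From mathcomp Require Import all_boot all_order all_algebra.
From mathcomp Require Import reals exp.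

Set Implicit Arguments.
Unset Strict Implicit.
Unset Printing Implicit Defensive.

Record sgraph := SGraph {
  vertex :> finType;
  edge : rel vertex;
  edge_sym : symmetric edge;
  edge_irrefl : irreflexive edge
}.

Section Deletion.
Variables (G : sgraph) (X : {set G}).

Definition del_edge : rel {x : G | x \notin X} :=
  fun x y => edge (val x) (val y).

Lemma del_edge_sym : symmetric del_edge.
Proof. by move=> x y; apply: edge_sym. Qed.

Lemma del_edge_irrefl : irreflexive del_edge.
Proof. by move=> x; apply: edge_irrefl. Qed.

Definition del_vertices : sgraph := SGraph del_edge_sym del_edge_irrefl.

Definition del_set (S : {set G}) : {set del_vertices} :=
  [set x : {x : G | x \notin X} | val x \in S]%SET.

End Deletion.

(* A cycle is given by its cyclic sequence of distinct vertices, at least three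
   of them, so [size c] is also its number of edges. *)
Definition is_cycle (G : sgraph) (c : seq G) : bool :=
  [&& 2 < size c, cycle (@edge G) c & uniq c].

Definition S_cycle (G : sgraph) (S : {set G}) (c : seq G) : bool :=
  is_cycle c && has [in S] c.

Definition long_S_cycle (G : sgraph) (S : {set G}) (l : nat) (c : seq G) : bool :=
  S_cycle S c && (l <= size c).

Definition log2 (R : realType) (x : R) : R := (ln x / ln 2)%R.

(* Main.v *)
Require Import Defs.
From mathcomp Require Import all_boot all_order all_algebra.
From mathcomp Require Import reals exp.
From mathcomp Require Import boolp zify lra.

(** Call a cycle long if it is an [S]-cycle of length at least [l].  Let [D] be a subgraph
    with all degrees 2 or 3, all of whose cycles are long, chosen to maximise first the
    number of branch vertices (those of degree 3) and then the number of [S]-vertices it covers.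

    If [D] has at least some constant times [k log k] branch vertices, then it contains [k]
    disjoint cycles: a subdivided cubic graph has a cycle through only logarithmically many
    branch vertices, and deleting such a cycle costs few branch vertices (Erdos-Posa, Simonovits).

    Otherwise delete the branch vertices and one vertex of each cycle component of [D]; a
    disjoint union of paths [F] remains.  Walk from each deleted vertex along [F] and also
    delete everything within distance [l] of the starting point and of the first [S]-vertex
    met.  By maximality, every ear of [D] avoiding these [O(l k log k)] vertices either has its
    ends at distance at most [l] on one path of [F], with an [S]-vertex between them, or misses
    [S] and joins two vertices that are already joined in [D - S].  So the remaining long
    cycles are confined to stretches of the paths of [F], and behave like intervals: a cycle
    with leftmost last vertex on [F] can be separated from all the others by deleting [l]-balls
    around the two [S]-vertices enclosing that vertex, and a cycle meeting [D] in a single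
    vertex by deleting the [l]-ball around it.  Fewer than [k] greedy steps suffice
    unless [k] disjoint long cycles appear. *)

Set Implicit Arguments.
Unset Strict Implicit.
Unset Printing Implicit Defensive.

(** * Symmetric sets of darts *)

Section Darts.
Variable T : finType.
Implicit Types (D E : {set T * T}) (W : {set T}) (c p q : seq T).

(** A subgraph is kept as a symmetric set of ordered pairs, so that each edge counts as two darts.
    Subgraphs then form a finite type, over which one can maximise. *)
Definition drel D : rel T := fun x y => (x, y) \in D.
Definition nb D x := [set y | (x, y) \in D].
Definition deg D x := #|nb D x|.
Definition supp D := [set x | 0 < deg D x].
Definition branch D := [set x | deg D x == 3].
Definition dcycle D c := [&& 2 < size c, cycle (drel D) c & uniq c].
Definition induced D W := [set d in D | (d.1 \in W) && (d.2 \in W)].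

Lemma in_nb D x y : (y \in nb D x) = ((x, y) \in D).
Proof. by rewrite inE. Qed.

Lemma dart_sym D x y : symmetric (drel D) -> (x, y) \in D -> (y, x) \in D.
Proof. by move=> sD; have := sD x y; rewrite /drel => ->. Qed.

Lemma dart_neq D x y : irreflexive (drel D) -> (x, y) \in D -> x != y.
Proof. by move=> iD; apply: contraTneq => ->; apply/negbT/iD. Qed.

Lemma induced_sym D W : symmetric (drel D) -> symmetric (drel (induced D W)).
Proof.
by move=> sD x y; rewrite /drel !inE /= -!/(drel D _ _) (sD x y) [(y \in W) && _]andbC.
Qed.

Lemma induced_sub D W : induced D W \subset D.
Proof. by apply/subsetP=> d; rewrite inE => /andP[]. Qed.

Lemma induced_mono D W W' : W \subset W' -> induced D W \subset induced D W'.
Proof.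
move=> /subsetP sWW'; apply/subsetP=> d; rewrite !inE => /and3P[-> h1 h2].
by rewrite !sWW'.
Qed.

Lemma path_mono D E x p : D \subset E -> path (drel D) x p -> path (drel E) x p.
Proof. by move=> /subsetP sDE; apply: sub_path => a b; apply: sDE. Qed.

Lemma dcycle_mono D E c : D \subset E -> dcycle D c -> dcycle E c.
Proof.
move=> /subsetP sDE /and3P[h1 h2 h3]; rewrite /dcycle h1 h3 andbT /=.
by apply: sub_cycle h2 => a b; apply: sDE.
Qed.

Lemma connect_mono D E x y :
  D \subset E -> connect (drel D) x y -> connect (drel E) x y.
Proof. by move=> sDE /connectP[p hp ->]; apply/connectP; exists p => //; apply: path_mono hp. Qed.

Lemma supp_mono D E : D \subset E -> supp D \subset supp E.
Proof.
move=> /subsetP sDE; apply/subsetP=> x; rewrite !inE !card_gt0 => /set0Pn[y].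
by rewrite inE => /sDE hy; apply/set0Pn; exists y; rewrite inE.
Qed.

Lemma deg_mono D E x : D \subset E -> deg D x <= deg E x.
Proof.
move=> /subsetP sDE; apply/subset_leq_card/subsetP=> y; rewrite !inE; exact: sDE.
Qed.

Lemma supp_dart D x y : (x, y) \in D -> x \in supp D.
Proof. by move=> h; rewrite inE card_gt0; apply/set0Pn; exists y; rewrite inE. Qed.

Lemma suppP D x : reflect (exists y, (x, y) \in D) (x \in supp D).
Proof.
apply: (iffP idP) => [|[y]]; last exact: supp_dart.
by rewrite inE card_gt0 => /set0Pn[y]; rewrite inE => h; exists y.
Qed.

Lemma path_induced D W x p :
  path (drel D) x p -> {subset x :: p <= W} -> path (drel (induced D W)) x p.
Proof.
elim: p x => //= y p IH x /andP[h1 h2] hs.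
rewrite IH // ?andbT; last by move=> z hz; apply: hs; rewrite inE hz orbT.
rewrite /drel inE /= -/(drel D x y) h1 !hs //; first by rewrite inE mem_head orbT.
by rewrite mem_head.
Qed.

Lemma induced_path D W x p :
  path (drel (induced D W)) x p -> path (drel D) x p /\ {subset p <= W}.
Proof.
elim: p x => //= y p IH x /andP[]; rewrite {1}/drel inE /= => /and3P[h1 h2 h3] /IH[h4 h5].
split; first by rewrite h4 andbT.
by move=> z; rewrite inE => /predU1P[->|/h5].
Qed.

Lemma card_darts D : #|D| = \sum_x deg D x.
Proof.
rewrite -sum1_card (eq_bigr (fun x => \sum_(y | (x, y) \in D) 1)); last first.
  by move=> x _; rewrite /deg -sum1_card; apply: eq_bigl => y; rewrite inE.
by rewrite pair_big_dep /=; apply: eq_bigl => [[x y]].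
Qed.

Lemma dcycle_rot D n c : dcycle D (rot n c) = dcycle D c.
Proof. by rewrite /dcycle size_rot rot_cycle rot_uniq. Qed.

Lemma dcycle_rev D c : symmetric (drel D) -> dcycle D (rev c) = dcycle D c.
Proof.
move=> sD; rewrite /dcycle size_rev rev_uniq rev_cycle.
by congr [&& _, _ & _]; apply: eq_cycle => x y; rewrite sD.
Qed.

Lemma rev_path_sym (e : rel T) x p :
  symmetric e -> path e (last x p) (rev (belast x p)) = path e x p.
Proof. by move=> se; rewrite rev_path; apply: eq_path => a b; rewrite se. Qed.

Lemma dcycle_nbrs D c x : symmetric (drel D) -> dcycle D c -> x \in c ->
  [/\ (x, next c x) \in D, (x, prev c x) \in D & next c x != prev c x].
Proof.
move=> sD /and3P[sc cc uc] xc; split; first exact: (next_cycle cc).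
  by have := prev_cycle cc xc; rewrite sD.
apply/eqP=> enp; have := next_prev uc x; rewrite -enp.
case/rot_to: xc => i q eq; rewrite -!(next_rot i uc) eq.
have uq : uniq (x :: q) by rewrite -eq rot_uniq.
have : 2 < size (x :: q) by rewrite -eq size_rot.
case: q {eq} uq => [|a [|b q]] //=; rewrite !inE !negb_or eqxx.
move=> /andP[/and3P[nxa nxb _] _] _; rewrite eq_sym (negbTE nxa) eqxx => e.
by rewrite e eqxx in nxb.
Qed.

Lemma dcycle_deg D c x : symmetric (drel D) -> dcycle D c -> x \in c -> 1 < deg D x.
Proof.
move=> sD hc xc; case: (dcycle_nbrs sD hc xc) => h1 h2 h3.
apply: (@leq_trans #|[set next c x; prev c x]|); first by rewrite cards2 h3.
by apply/subset_leq_card/subsetP=> y; rewrite !inE => /orP[]/eqP->.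
Qed.

Lemma dcycle_nb D c x y : symmetric (drel D) -> dcycle D c -> x \in c -> deg D x <= 2 ->
  (x, y) \in D -> y \in c.
Proof.
move=> sD hc xc hd hy; case: (dcycle_nbrs sD hc xc) => h1 h2 h3.
have hs : [set next c x; prev c x] \subset nb D x.
  by apply/subsetP=> z; rewrite !inE => /orP[]/eqP->.
have /eqP e : [set next c x; prev c x] == nb D x by rewrite eqEcard hs cards2 h3.
have : y \in nb D x by rewrite inE.
by rewrite -e !inE => /orP[]/eqP->; rewrite ?mem_next ?mem_prev.
Qed.

(** Shorten the walk from [x] to [x'] to a simple path and close it through [y]; since [x != x'],
    the result has at least three vertices. *)
Lemma dcycle_of_connect D W x x' y : symmetric (drel D) -> y \notin W -> x != x' ->
  (y, x) \in D -> (y, x') \in D -> x \in W -> connect (drel (induced D W)) x x' ->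
  exists2 c, dcycle D c & {subset c <= y |: W}.
Proof.
move=> sD yW nxx hyx hyx' xW /connectP[p0 hp0 ex'].
case/shortenP: hp0 ex' => p hp up _ ex'.
have [hpD hpW] := induced_path hp.
have hW : {subset x :: p <= W} by move=> z /predU1P[->|/hpW].
exists [:: y, x & p]; last first.
  by move=> z; rewrite in_cons => /predU1P[->|/hW hz]; rewrite !inE ?eqxx ?hz ?orbT.
have nyp : y \notin x :: p by apply: contra yW => /hW.
rewrite /dcycle [uniq _]cons_uniq nyp up /= {1}/drel hyx rcons_path hpD -ex' -sD {1}/drel hyx'.
rewrite !andbT; by case: p ex' {hp up hpD hpW hW nyp} nxx => //= ->; rewrite eqxx.
Qed.

(** Grow a simple path at its first vertex: a degree other than 1 supplies a further neighbour,
    which is either new or closes a cycle with part of the path. *)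
Lemma long_path_or_cycle D n : symmetric (drel D) -> irreflexive (drel D) ->
  (forall x, deg D x != 1) -> D != set0 ->
  (exists c, dcycle D c) \/ (exists x p, [/\ path (drel D) x p, uniq (x :: p) & size p = n.+1]).
Proof.
move=> sD iD hd /set0Pn[[x y] hxy]; elim: n => [|n [|[{y hxy} x0 [p [hp up sp]]]]].
- right; exists x, [:: y]; split=> //=; first by rewrite /drel hxy.
  by rewrite !inE andbT; apply: contraTneq hxy => ->; rewrite -/(drel D y y) iD.
- by left.
case: p hp up sp => // a p hp up sp.
have /andP[hxa hpa] := hp.
have : 1 < deg D x0.
  have := hd x0; have := supp_dart hxa; rewrite inE; lia.
rewrite /deg (cardsD1 a) inE -/(drel D x0 a) hxa add1n ltnS card_gt0 => /set0Pn[z].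
rewrite !inE => /andP[nza hxz].
have nzx : z != x0 by apply: contraTneq hxz => ->; rewrite -/(drel D x0 x0) iD.
have [zp|zp] := boolP (z \in x0 :: a :: p); last first.
  right; exists z, [:: x0, a & p]; split; last by rewrite /= -sp.
    by rewrite /= -/(path (drel D) x0 (a :: p)) hp andbT sD.
  by rewrite cons_uniq zp.
left; have := zp; rewrite !inE (negbTE nza) (negbTE nzx) /=.
move=> zp'; case/splitPr: zp' hp up => p1 p2 hp up.
exists [:: x0, a & rcons p1 z]; rewrite /dcycle; apply/and3P; split.
- by rewrite /= size_rcons.
- rewrite /= hxa rcons_path last_rcons [drel D z x0]sD {2}/drel hxz andbT.
  by move: hp; rewrite /= cat_path rcons_path /= => /and3P[_ -> /andP[-> _]].
have : subseq [:: x0, a & rcons p1 z] [:: x0, a & p1 ++ z :: p2].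
  by rewrite -cat_rcons -!cat_cons prefix_subseq.
by move/subseq_uniq; apply.
Qed.

Lemma acyclic_leaf D : symmetric (drel D) -> irreflexive (drel D) -> D != set0 ->
  (forall c, ~~ dcycle D c) -> exists x, deg D x = 1.
Proof.
move=> sD iD hD hc; apply: contrapT => hn.
have hd x : deg D x != 1 by apply/eqP=> e; apply: hn; exists x.
case: (long_path_or_cycle #|T| sD iD hd hD) => [[c h]|[x [p [_ up sp]]]].
  by have := hc c; rewrite h.
by have := max_card [in x :: p]; rewrite (card_uniqP up) /= sp => /ltnW; rewrite ltnn.
Qed.

(** Repeatedly take a member [c] and delete its set [Y]; everything left is then disjoint from [c].
    The factor is [k.-1] because the [k]-th member ends the process and nothing has to be deleted
    for it. *)
Lemma greedy_packing (P : seq T -> Prop) m :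
  (forall Z : {set T}, (exists2 c, P c & [disjoint c & Z]) ->
     exists c (Y : {set T}), [/\ P c, [disjoint c & Z], #|Y| <= m &
       forall c', P c' -> [disjoint c' & Z] -> [disjoint c' & Y] -> [disjoint c & c']]) ->
  forall k, (exists C : 'I_k -> seq T, (forall i, P (C i)) /\
                 (forall i j, i != j -> [disjoint C i & C j])) \/
            (exists2 X : {set T}, #|X| <= k.-1 * m & forall c, P c -> ~~ [disjoint c & X]).
Proof.
move=> step k.
(* The induction is on the number of members still wanted, with the set [Z] of vertices already
   deleted as a parameter. *)
have Ex (Z : {set T}) n : (exists C : 'I_n -> seq T, (forall i, P (C i) /\ [disjoint C i & Z]) /\
                 (forall i j, i != j -> [disjoint C i & C j])) \/
            (exists2 X : {set T}, #|X| <= n.-1 * m & forall c, P c -> ~~ [disjoint c & Z :|: X]).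
  elim: n Z => [|n IH] Z; first by left; exists (fun=> [::]); split=> -[].
  have [[c0 h1 h2]|none] := EM (exists2 c, P c & [disjoint c & Z]); last first.
    right; exists set0; rewrite ?cards0 // => c hc; apply/negP; rewrite setU0 => hd.
    by apply: none; exists c.
  have [c [Y [hc hcZ sY hY]]] := step Z ltac:(by exists c0).
  case: n IH => [|n] IH.
    left; exists (fun=> c); split=> // i j; by rewrite (ord1 i) (ord1 j).
  case: (IH (Z :|: Y)) => [[C [hC1 hC2]]|[X sX hX]]; last first.
    right; exists (Y :|: X); last by move=> c' /hX; rewrite setUA.
    by rewrite (leq_trans (leq_card_setU _ _)) //= mulSn leq_add.
  left; exists (fun i => if unlift ord0 i is Some j then C j else c); split.
    move=> i; case: unliftP => [j _|_] //; case: (hC1 j) => h3 h4; split=> //.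
    by apply: disjointWr h4; apply: subsetUl.
  have hcC j : [disjoint c & C j].
    case: (hC1 j) => h3 h4; apply: hY h3 _ _; apply: disjointWr h4.
      exact: subsetUl.
    exact: subsetUr.
  move=> i j; case: unliftP => [i' ->|->]; case: unliftP => [j' ->|->] //.
  - by rewrite (inj_eq lift_inj); apply: hC2.
  - by move=> _; rewrite disjoint_sym; apply: hcC.
case: (Ex set0 k) => [[C [h1 h2]]|[X h1 h2]]; [left; exists C; split=> // i|right; exists X => // c].
  by case: (h1 i).
by move=> /h2; rewrite set0U.
Qed.

End Darts.

(** * Numberings of linear forests *)

Section Numbering.
Variables (T : finType) (F : {set T * T}) (N : T -> nat).
Implicit Types (p : seq T) (x y z v : T).

(** [N] is a coordinate along each path of a disjoint union of paths, so that order, distance and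
    balls on these paths become arithmetic on labels. Labels in different components are
    unrelated. *)
Definition numbering :=
  (forall x y, (x, y) \in F -> N x = (N y).+1 \/ N y = (N x).+1) /\
  (forall x y, connect (drel F) x y -> N x = N y -> x = y).

Definition nbetween x y v := (N x <= N v <= N y) || (N y <= N v <= N x).
Definition ball l z := [set v | connect (drel F) z v && (N v <= N z + l) && (N z <= N v + l)].
Definition ndist x y := (N x - N y) + (N y - N x).

Hypothesis numN : numbering.
Hypothesis sF : symmetric (drel F).

Let cS : connect_sym (drel F) := sym_connect_sym sF.

Lemma dist_path x p : path (drel F) x p -> ndist x (last x p) <= size p.
Proof.
rewrite /ndist; elim: p x => [|y p IH] x /=; first by lia.
by move=> /andP[/numN.1 h /IH]; lia.
Qed.

(** A discrete intermediate value theorem: labels change by one at each step, so the path takes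
    every value in between, and within a component the label determines the vertex. *)
Lemma path_between x p v : path (drel F) x p -> connect (drel F) x v ->
  nbetween x (last x p) v -> v \in x :: p.
Proof.
rewrite /nbetween; elim: p x => [|y p IH] x /=.
  by move=> _ cv h; rewrite inE; apply/eqP/esym; apply: numN.2 => //; lia.
move=> /andP[hxy hp] cv h; rewrite inE; case: (eqVneq v x) => //= nvx.
apply: IH => //; first by rewrite (connect_trans _ cv) // connect1 // sF.
have nN : N v <> N x by move=> e; move/eqP: nvx; apply; apply/esym/numN.2.
by case: (numN.1 _ _ hxy) => e; lia.
Qed.

(** Take the first step of a simple path to [y]. If it went down, the rest of the path would have to
    pass [x] again, by [path_between]. *)
Lemma connect_step x y : connect (drel F) x y -> N x < N y ->
  exists2 z, (x, z) \in F & N z = (N x).+1.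
Proof.
case/connectP=> p0 hp0 ->; case/shortenP: hp0 => p hp up _.
case: p hp up => [|a p] /=; first by lia.
move=> /andP[hxa hp] /andP[xp _] h; case: (numN.1 _ _ hxa) => e; last by exists a.
case/negP: xp; apply: path_between => //; first by rewrite connect1 // sF.
by rewrite /nbetween; lia.
Qed.

Lemma connect_step_down x y : connect (drel F) x y -> N y < N x ->
  exists2 z, (x, z) \in F & N x = (N z).+1.
Proof.
case/connectP=> p0 hp0 ->; case/shortenP: hp0 => p hp up _.
case: p hp up => [|a p] /=; first by lia.
move=> /andP[hxa hp] /andP[xp _] h; case: (numN.1 _ _ hxa) => e; first by exists a.
case/negP: xp; apply: path_between => //; first by rewrite connect1 // sF.
by rewrite /nbetween; lia.
Qed.

(** With [x] and [y] on opposite sides of [b], the steps towards them would give [b] two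
    neighbours. *)
Lemma end_one_sided b x y : deg F b <= 1 -> connect (drel F) b x -> connect (drel F) b y ->
  (N b <= N x) && (N b <= N y) || (N x <= N b) && (N y <= N b).
Proof.
move=> hd cx cy; apply: contraLR hd => h; rewrite -ltnNge.
suff [z1 [z2 [h1 h2 h3]]] : exists z1 z2, [/\ (b, z1) \in F, (b, z2) \in F & z1 != z2].
  apply: (@leq_trans #|[set z1; z2]|); first by rewrite cards2 h3.
  by apply/subset_leq_card/subsetP=> y'; rewrite !inE => /orP[]/eqP->.
have {h} [[h1 h2]|[h1 h2]] : N x < N b /\ N b < N y \/ N y < N b /\ N b < N x by lia.
  have [z1 h3 h4] := connect_step_down cx h1; have [z2 h5 h6] := connect_step cy h2.
  by exists z1, z2; split=> //; apply/eqP=> e; move: h4 h6; rewrite e; lia.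
have [z1 h3 h4] := connect_step_down cy h1; have [z2 h5 h6] := connect_step cx h2.
by exists z1, z2; split=> //; apply/eqP=> e; move: h4 h6; rewrite e; lia.
Qed.

Lemma card_ball l z : #|ball l z| <= l.*2.+1.
Proof.
(* Shifting labels by [l - N z] maps the ball injectively into [0, ..., 2 * l]. *)
have inj : {in ball l z &, injective (fun v => inord (N v + l - N z) : 'I_(l.*2.+1))}.
  move=> v w; rewrite !inE => /andP[/andP[cv h1] h2] /andP[/andP[cw h3] h4] /(congr1 val).
  rewrite /= !inordK; try lia; move=> e; apply: numN.2; last by lia.
  by rewrite (connect_trans _ cw) // cS.
rewrite -(card_in_imset inj); apply: leq_trans (max_card _) _; by rewrite card_ord.
Qed.

End Numbering.

(** Induction on the number of darts: remove a leaf [v], number the rest, and give [v] a free label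
    next to that of its neighbour [w]. *)
Lemma numbering_exists (T : finType) (F : {set T * T}) :
  symmetric (drel F) -> irreflexive (drel F) -> (forall x, deg F x <= 2) ->
  (forall c, ~~ dcycle F c) -> exists N, numbering F N.
Proof.
have [n] := ubnP #|F|; elim: n F => // n IH F; rewrite ltnS => hn sF iF dF cF.
have [F0|nF0] := eqVneq F set0.
  exists (fun=> 0); split=> x y; first by rewrite F0 inE.
  by case/connectP=> -[|a p] //= /andP[]; rewrite /drel F0 inE.
have [v dv] := acyclic_leaf sF iF nF0 cF.
have /cards1P[w nbv] : #|nb F v| == 1 by apply/eqP.
have hvw : (v, w) \in F by have : w \in nb F v; [rewrite nbv inE | rewrite inE].
have nvw : v != w by apply: contraTneq hvw => ->; rewrite -/(drel F w w) iF.
have vE y : (v, y) \in F -> y = w.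
  by move=> h; apply/eqP; rewrite -in_set1 -nbv inE.
pose F' := induced F (~: [set v]).
have sF'F : F' \subset F by apply: induced_sub.
have sF' : symmetric (drel F') by apply: induced_sym.
have F'E a b : (a, b) \in F' = ((a, b) \in F) && (a != v) && (b != v).
  by rewrite !inE /= andbA.
have [] := IH F'.
- apply: leq_trans hn; apply: proper_card; apply/properP; split=> //.
  by exists (v, w) => //; rewrite F'E eqxx andbF.
- done.
- by move=> x; rewrite /drel F'E -/(drel F x x) iF.
- by move=> x; apply: leq_trans (dF x); apply: deg_mono.
- by move=> c; apply: contra (cF c); apply: dcycle_mono.
move=> N0 nN0.
(* the value given to [v] must differ from that of the other neighbour of [w] *)
have [k [hk hfree]] : exists k, ((k = (N0 w).+2) \/ (k = N0 w)) /\
    forall z, connect (drel F') w z -> (N0 z).+1 <> k.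
  have [[z hz ez]|none] := EM (exists2 z, (w, z) \in F' & N0 z = (N0 w).+1).
    exists (N0 w); split; [by right | move=> u cu eu].
    have [z' hz' ez'] : exists2 z, (w, z) \in F' & N0 w = (N0 z).+1.
      by apply: (connect_step_down nN0 sF' cu); lia.
    (* If the label below [w] were taken as well, then [w] would have a neighbour on either side
       besides [v]. *)
    have : 2 < deg F w.
      have u3 : uniq [:: v; z; z'].
        rewrite /= !inE !andbT negb_or; apply/andP; split; last first.
          by apply/eqP=> e; move: ez ez'; rewrite e; lia.
        move: hz hz'; rewrite !F'E => /andP[_ nz] /andP[_ nz'].
        by rewrite ![v == _]eq_sym nz nz'.
      rewrite -[3]/(size [:: v; z; z']) -(card_uniqP u3); apply/subset_leq_card/subsetP=> y.
      rewrite !inE => /or3P[]/eqP->; first by rewrite -/(drel F w v) sF.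
        by move: hz; rewrite F'E => /andP[/andP[]].
      by move: hz'; rewrite F'E => /andP[/andP[]].
    by have := dF w; lia.
  exists (N0 w).+2; split; [by left | move=> u cu eu].
  by apply: none; apply: (connect_step nN0 sF' cu); lia.
(* The old labels move up by one so that there is always room for a label below that of [w]. *)
pose N x := if x == v then k else (N0 x).+1.
have NF' x : x != v -> N x = (N0 x).+1 by rewrite /N => /negbTE->.
have Nv : N v = k by rewrite /N eqxx.
exists N; split.
  move=> x y hxy; have [xv|nxv] := eqVneq x v.
    rewrite xv in hxy *; rewrite (vE _ hxy) Nv NF' 1?eq_sym //; lia.
  have [yv|nyv] := eqVneq y v.
    have hyx : (v, x) \in F by rewrite -/(drel F v x) sF -yv.
    rewrite yv Nv NF' // (vE _ hyx); lia.
  have : (x, y) \in F' by rewrite F'E hxy nxv.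
  by rewrite !NF' // => /nN0.1; lia.
(* A simple path between other vertices avoids the leaf [v], since it would have to enter and leave
   [v] through [w]. *)
have conn x y : x != v -> y != v -> connect (drel F) x y -> connect (drel F') x y.
  move=> nxv nyv /connectP[p0 hp0 ey]; case/shortenP: hp0 ey => p hp up _ ey.
  apply/connectP; exists p => //; apply: path_induced => // z hz.
  rewrite !inE; apply: contraNneq nyv => zv; rewrite {}zv in hz.
  rewrite inE eq_sym (negbTE nxv) /= in hz.
  case/splitPr: hz hp up ey => p1 p2; rewrite cat_path last_cat => /andP[_ hp] up ey.
  case: p2 hp up ey => [|b p2]; first by move=> _ _ /= ->.
  case/and3P=> h1 /vE eb _; rewrite -cat_cons cat_uniq => /and3P[_ /hasPn /(_ b) + _] _.
  rewrite !inE eqxx orbT => /(_ isT); have -> : b = last x p1.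
    by rewrite eb; apply/esym/vE; have := h1; rewrite sF.
  by rewrite -in_cons mem_last.
have connv y : y != v -> connect (drel F) v y -> connect (drel F') w y.
  move=> nyv cvy; apply: conn => //; first by rewrite eq_sym.
  by apply: connect_trans cvy; rewrite connect1 // sF.
have cS : connect_sym (drel F) := sym_connect_sym sF.
move=> x y cxy; have [xv|nxv] := eqVneq x v; have [yv|nyv] := eqVneq y v.
- by rewrite xv yv.
- rewrite xv in cxy *; rewrite Nv NF' // => e; by case: (hfree _ (connv _ nyv cxy)).
- rewrite yv cS in cxy *; rewrite Nv NF' // => e; by case: (hfree _ (connv _ nxv cxy)).
- by rewrite !NF' // => -[e]; apply: nN0.2 => //; apply: conn.
Qed.

(** * Disjoint cycles in subdivided cubic graphs *)

Lemma ex_maximal (A : finType) (P : A -> Prop) (f : A -> nat) a0 :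
  P a0 -> exists2 a, P a & forall b, P b -> f b <= f a.
Proof.
move=> h; have h' : `[<P a0>] by apply/asboolP.
case: (arg_maxnP (P := fun a => `[<P a>]) f h') => a /asboolP Pa ha.
by exists a => // b /asboolP hb; apply: ha.
Qed.

Lemma card_darts_from (T : finType) (D : {set T * T}) (B : {set T}) :
  #|[set d in D | d.1 \in B]| = \sum_(x in B) deg D x.
Proof.
rewrite -sum1_card (eq_bigr (fun x => \sum_(y | (x, y) \in D) 1)); last first.
  by move=> x _; rewrite /deg -sum1_card; apply: eq_bigl => y; rewrite inE.
rewrite pair_big_dep /=; apply: eq_bigl => [[x y]]; by rewrite inE /= andbC.
Qed.

(** * Exponential growth of balls when every cycle has many branch vertices *)

Section BallGrowth.
Variables (T : finType) (D : {set T * T}) (i : nat) (u : T).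
Hypotheses (sD : symmetric (drel D)) (iD : irreflexive (drel D)).
Hypothesis degD : forall x, deg D x != 1.
Hypothesis cycD : forall c, dcycle D c -> 2 * i + 3 < #|[set x in c] :&: branch D|.
Hypothesis hu : u \in branch D.

(** Distance from [u] is counted in branch vertices, so vertices of degree 2 cost nothing. The
    witness is a set rather than a path, which makes it easy to take unions. *)
Definition reach j (B : {set T}) x := exists2 W : {set T},
  [/\ W \subset B, u \in W & x \in W] &
  #|W :&: branch D| <= j.+1 /\ connect (drel (induced D W)) u x.

(* Each edge is two darts, so the third condition bounds the edges within [B] by [#|B| - 1]. *)
Definition tree_ball j (B : {set T}) :=
  [/\ u \in B, B \subset supp D, #|induced D B| + 2 <= 2 * #|B| &
      forall x, x \in B -> reach j B x].

(** Two neighbours of [y] in the ball would close a cycle inside the union of their witnesses and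
    [y], with at most [2 * (j + 1) + 1] branch vertices, against [cycD]. *)
Lemma tree_ball_nbr j B x x' y : j <= i -> tree_ball j B -> y \notin B ->
  x \in B -> x' \in B -> (y, x) \in D -> (y, x') \in D -> x = x'.
Proof.
move=> ji [_ _ _ hB] yB xB x'B yx yx'; apply: contrapT => /eqP nxx.
have [W [WB uW xW] [cW kW]] := hB _ xB; have [W' [WB' uW' xW'] [cW' kW']] := hB _ x'B.
have sW : W :|: W' \subset B by rewrite subUset WB.
have kk : connect (drel (induced D (W :|: W'))) x x'.
  have cS := sym_connect_sym (induced_sym (W :|: W') sD).
  apply: (@connect_trans _ _ u).
    by rewrite cS; apply: connect_mono kW; apply/induced_mono/subsetUl.
  by apply: connect_mono kW'; apply/induced_mono/subsetUr.
case: (dcycle_of_connect sD _ nxx yx yx' _ kk).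
- by apply: contra yB => /(subsetP sW).
- by rewrite inE xW.
move=> c hc sc; have := cycD hc; rewrite ltnNge => /negP; apply.
apply: (@leq_trans #|[set y] :|: (W :&: branch D) :|: (W' :&: branch D)|).
  apply/subset_leq_card/subsetP=> z; rewrite !inE => /andP[/sc + ->].
  by rewrite !inE !andbT orbA.
apply: leq_trans (leq_card_setU _ _) _.
apply: leq_trans (leq_add (leq_card_setU _ _) (leqnn _)) _; rewrite cards1.
move: cW cW' ji; clear; move: #|_| #|_| => a b; lia.
Qed.

(** By [tree_ball_nbr] the new vertex brings exactly one edge, hence two darts, and the bound on the
    darts inside is preserved. *)
Lemma tree_ball_add j B x y : j <= i -> tree_ball j B -> y \notin B ->
  (x, y) \in D -> forall W : {set T}, [/\ W \subset B, u \in W & x \in W] ->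
  #|(y |: W) :&: branch D| <= j.+1 -> connect (drel (induced D W)) u x ->
  tree_ball j (y |: B).
Proof.
move=> ji hJ yB xy W [WB uW xW] cW kW; have [uB sB eB hB] := hJ.
have yx : (y, x) \in D by exact: dart_sym sD xy.
have xB := subsetP WB _ xW.
split.
- by rewrite inE uB orbT.
- by rewrite subUset sB sub1set (supp_dart yx).
- have nE z : (y, z) \in D -> z \in y |: B -> z = x.
    move=> yz; rewrite !inE => /predU1P[ez|zB].
      by move: (dart_neq iD yz); rewrite ez eqxx.
    exact: (tree_ball_nbr ji hJ yB zB xB yz yx).
  have sE : induced D (y |: B) \subset induced D B :|: [set (x, y); (y, x)].
    apply/subsetP=> -[a b]; rewrite in_setU [_ \in induced D (y |: B)]inE /=.
    case/and3P=> hab ha hb; have [ea|na] := eqVneq a y.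
      by rewrite ea in hab *; rewrite (nE b hab hb) !inE eqxx !orbT.
    have [eb|nb] := eqVneq b y.
      have hba : (y, a) \in D by apply: dart_sym sD _; rewrite -eb.
      by rewrite eb (nE a hba ha) !inE eqxx orbT.
    move: ha hb; rewrite !inE (negbTE na) (negbTE nb) /= => ha hb.
    by rewrite hab ha hb.
  have nxy : (x, y) != (y, x).
    by apply: contra (dart_neq iD xy) => /eqP[-> _].
  have := subset_leq_card sE; have := (leq_card_setU (induced D B) [set (x, y); (y, x)]).1.
  rewrite cards2 nxy cardsU1 yB /= add1n; move: eB; clear.
  by move: #|_| #|_| #|_| #|_| => a b c d; lia.
- move=> z; rewrite in_setU1 => /predU1P[->|zB].
    exists (y |: W).
      by split; rewrite ?inE ?eqxx ?uW ?orbT // setUS.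
    split=> //; apply: connect_trans (connect_mono (induced_mono _ (subsetUr _ _)) kW) _.
    by apply: connect1; rewrite /drel inE xy !inE eqxx xW orbT.
  have [W' [h1 h2 h3] [h4 h5]] := hB _ zB; exists W' => //; split=> //.
  exact: subset_trans h1 (subsetUr _ _).
Qed.

Lemma sum_deg_ge (B : {set T}) : B \subset supp D ->
  #|B|.*2 + #|B :&: branch D| <= \sum_(x in B) deg D x.
Proof.
move=> sB; rewrite -[#|_ :&: _|]sum1_card -[#|B|]sum1_card -muln2 big_distrl /=.
have -> : \sum_(x in B :&: branch D) 1 = \sum_(x in B) (x \in branch D : nat).
  rewrite big_mkcond [RHS]big_mkcond; apply: eq_bigr => x _; rewrite in_setI.
  by case: (x \in B); case: (x \in branch D).
rewrite -big_split /=; apply: leq_sum => x /(subsetP sB); rewrite !inE.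
by have := degD x; case: eqP => [->|]; lia.
Qed.

Definition full_ball j B := tree_ball j B /\ forall y, y \notin B -> ~ tree_ball j (y |: B).

(** The darts leaving [B] outnumber its branch vertices. Their heads are distinct by
    [tree_ball_nbr], are branch vertices because [B] is full, and lie in any full ball of the next
    level that contains [B]. So the number of branch vertices doubles. *)
Lemma full_ball_grow j B : j < i -> full_ball j B ->
  exists2 B', full_ball j.+1 B' & (#|B :&: branch D|).*2 <= #|B' :&: branch D|.
Proof.
move=> ji [hJ maxB]; have [uB sB eB hB] := hJ.
have hJ1 : tree_ball j.+1 B.
  split=> // x /hB[W h1 [h2 h3]]; exists W => //; split=> //; exact: leqW.

have [B' [hB' sBB'] maxB'] := @ex_maximal _ (fun B' => tree_ball j.+1 B' /\ B \subset B')
   (fun B' => #|B'|) B (conj hJ1 (subxx _)).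
have addB' y : y \notin B' -> ~ tree_ball j.+1 (y |: B').
  move=> yB' h; have := maxB' (y |: B') (conj h (subset_trans sBB' (subsetUr _ _))).
  by rewrite cardsU1 yB' /= add1n ltnn.
exists B' => //.
pose L := [set d in D | (d.1 \in B) && (d.2 \notin B)].
(* The degrees in [B] sum to at least [2 * #|B|] plus the number of branch vertices, and at most
   [2 * #|B| - 2] darts stay inside. *)
have eL : #|B :&: branch D| + 2 <= #|L|.
  have := sum_deg_ge sB; rewrite -card_darts_from.
  have -> : #|[set d in D | d.1 \in B]| = #|induced D B| + #|L|.
    rewrite -(cardsID [set d : T * T | d.2 \in B]); congr (_ + _); apply: eq_card => d.
      by rewrite !inE andbA.
    by rewrite !inE andbC andbA.
  by move: eB; clear; move: #|_| #|_| #|_| #|_| => a b c d; lia.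
pose Y := [set d.2 | d in L].
have cY : #|Y| = #|L|.
  apply: card_in_imset => -[x y] [x' y']; rewrite !inE /= => /and3P[h1 h2 h3] /and3P[h4 h5 h6] e.
  rewrite -e in h4 *; congr (_, _).
  by apply: (tree_ball_nbr (ltnW ji) hJ h3 h2 h5); apply: dart_sym.
have sY : Y \subset (B' :&: branch D) :\: B.
  apply/subsetP=> _ /imsetP[[x y] + ->]; rewrite !inE /= => /and3P[xy xB yB].
  rewrite yB /=; have [W h1 [h2 h3]] := hB x xB.
  (* Otherwise [y] costs nothing and could be added to [B] at the same level [j]. *)
  have yb : deg D y == 3.
    apply: contraT => nb.
    case: (maxB y yB).
      apply: (tree_ball_add (ltnW ji) hJ yB xy h1) h3; apply: leq_trans h2.
      apply/subset_leq_card/subsetP=> z; rewrite !inE => /andP[/predU1P[->|->//]].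
      by rewrite (negbTE nb).
  rewrite yb andbT; apply: contraT => yB'.
  case: (addB' y yB').
    apply: (tree_ball_add ji hB' yB' xy _) h3.
      by case: h1 => h4 h5 h6; split=> //; apply: subset_trans sBB'.
    apply: (@leq_trans #|y |: (W :&: branch D)|).
      apply/subset_leq_card/subsetP=> z; rewrite !inE => /andP[/orP[]->//].
      by move=> ->; rewrite orbT.
    by rewrite cardsU1; apply: leq_trans (leq_add (leq_b1 _) h2) _; rewrite add1n.
have sBb : (B :&: branch D) :|: Y \subset B' :&: branch D.
  rewrite subUset setSI // (subset_trans sY) // subsetDl //.
have dBY : [disjoint B :&: branch D & Y].
  rewrite disjoint_sym; apply/pred0P => z /=; apply/negbTE; apply/negP=> /andP[/(subsetP sY)].
  by rewrite !inE => /andP[/negbTE->].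
have := subset_leq_card sBb.
rewrite cardsU (eqP (_ : B :&: branch D :&: Y == set0)) ?setI_eq0 // cards0 subn0 cY.
move: eL; clear; move: #|_| #|_| #|_| => a b c; lia.
Qed.

(** Start from a full ball containing the branch vertex [u] and double [i] times. *)
Lemma branch_exp : 2 ^ i <= #|branch D|.
Proof.
have hJ0 : tree_ball 0 [set u].
  have us : u \in supp D by move: hu; rewrite !inE => /eqP->.
  split; [by rewrite inE | by rewrite sub1set | rewrite cards1 |].
    rewrite (_ : induced _ _ = set0) ?cards0 //; apply/setP=> -[x y]; rewrite !inE /=.
    by apply/negP=> /and3P[/(dart_neq iD) + /eqP ex /eqP ey]; rewrite ex ey eqxx.
  move=> x; rewrite inE => /eqP->; exists [set u]; rewrite ?inE ?subxx ?eqxx //; split=> //.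
  by apply: leq_trans (subset_leq_card (subsetIl _ _)) _; rewrite cards1.
have [B0 [hB0 _] maxB0] := @ex_maximal _ (fun B => tree_ball 0 B /\ True) (fun B => #|B|) _ (conj hJ0 I).
have fB0 : full_ball 0 B0.
  split=> // y yB h; have := maxB0 (y |: B0) (conj h I).
  by rewrite cardsU1 yB /= add1n ltnn.
suff [B _ h] : exists2 B, full_ball i B & 2 ^ i <= #|B :&: branch D|.
  exact: leq_trans h (subset_leq_card (subsetIr _ _)).
have : i <= i by [].
elim: {1 3 4}i => [_|j IH ji].
  by exists B0 => //; rewrite card_gt0; apply/set0Pn; exists u; rewrite inE hu andbT; case: hB0.
have [B hB h] := IH (ltnW ji); have [B' hB' h'] := full_ball_grow ji hB.
by exists B' => //; apply: leq_trans h'; rewrite expnS mul2n leq_double.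
Qed.

End BallGrowth.

(** * Greedy removal of cycles with few branch vertices *)

Section Packing.
Variables (T : finType) (i : nat).
Implicit Types D : {set T * T}.
Let t := 2 * i + 3.

Lemma few_branch_cycle D : symmetric (drel D) -> irreflexive (drel D) ->
  (forall x, deg D x != 1) -> 0 < #|branch D| < 2 ^ i ->
  exists2 c, dcycle D c & #|[set x in c] :&: branch D| <= t.
Proof.
move=> sD iD dD /andP[/card_gt0P[u hu] hi]; apply: contrapT => hn.
have := @branch_exp _ D i u sD iD dD _ hu; rewrite leqNgt hi => H; suff: false by []; apply: H.
by move=> c hc; rewrite ltnNge; apply/negP=> h; apply: hn; exists c.
Qed.

(* Deleting an edge lowers [#|D|] by 2, so [D] minimal with this property
   has excess at most [2 * m + 1]. *)
Lemma prune_excess D m : 0 < m -> symmetric (drel D) -> irreflexive (drel D) ->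
  2 * #|supp D| + 2 * m <= #|D| ->
  exists E : {set T * T}, [/\ E \subset D, symmetric (drel E), (forall x, deg E x != 1) &
     2 * #|supp E| + 2 * m <= #|E| <= 2 * #|supp E| + 2 * m + 1].
Proof.
have [n] := ubnP #|D|; elim: n D => // n IH D; rewrite ltnS => hn m0 sD iD hm.
have del x y : (x, y) \in D -> exists E : {set T * T}, [/\ E \proper D, symmetric (drel E),
     #|D| = #|E| + 2 & forall a b, ((a, b) \in E) = ((a, b) \in D) && ((a, b) != (x, y)) && ((a, b) != (y, x))].
  move=> xy; exists (D :\ (x, y) :\ (y, x)).
  have nxy : (y, x) != (x, y) by apply: contra (dart_neq iD xy) => /eqP[-> _].
  have yx : (y, x) \in D :\ (x, y) by rewrite !inE nxy; apply: dart_sym.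
  have EE a b : ((a, b) \in D :\ (x, y) :\ (y, x)) = ((a, b) \in D) && ((a, b) != (x, y)) && ((a, b) != (y, x)).
    by rewrite !inE [RHS]andbC [X in _ && X]andbC.
  split=> //.
  - apply: sub_proper_trans (subD1set _ _) _; exact: properD1.
  - move=> a b; rewrite /drel !EE -!/(drel D _ _) sD !xpair_eqE -!andbA; congr (_ && _).
    by rewrite andbC [(b == x) && _]andbC [(b == y) && _]andbC.
  - by rewrite (cardsD1 (x, y)) xy (cardsD1 (y, x)) yx /= !add1n addn2.
have [[x dx]|dD] := EM (exists x, deg D x = 1).
  have /cards1P[y nbx] : #|nb D x| == 1 by apply/eqP.
  have xy : (x, y) \in D by have : y \in nb D x; [rewrite nbx inE | rewrite inE].
  have [E [/properP[sED _] sE eE EE]] := del _ _ xy.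
  have xE : x \notin supp E.
    apply/suppP=> -[z]; rewrite EE => /andP[/andP[h]]; have : z \in nb D x by rewrite inE.
    by rewrite nbx inE => /eqP->; rewrite eqxx.
  have sS : #|supp E| < #|supp D|.
    apply/proper_card/properP; split; first exact: supp_mono.
    by exists x => //; apply: supp_dart xy.
  have [|||E' [h1 h2 h3 h4]] := IH E _ m0 sE _ _.
  - by move: eE hn; clear; move: #|_| #|_| => a b; lia.
  - by move=> a; apply: contraFF (iD a); apply: (subsetP sED).
  - by move: eE hm sS; clear; move: #|_| #|_| #|_| #|_| => a b c d; lia.
  by exists E'; split=> //; apply: subset_trans sED.
have [hle|hlt] := leqP #|D| (2 * #|supp D| + 2 * m + 1).
  by exists D; split=> //; [move=> x; apply/eqP=> e; apply: dD; exists x | rewrite hm].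
have : D != set0 by rewrite -card_gt0; move: hlt; clear; move: #|_| #|_| => a b; lia.
case/set0Pn=> -[x y] xy; have [E [/properP[sED _] sE eE EE]] := del _ _ xy.
have sS : #|supp E| <= #|supp D| by apply/subset_leq_card/supp_mono.
have [|||E' [h1 h2 h3 h4]] := IH E _ m0 sE _ _.
- by move: eE hn; clear; move: #|_| #|_| => a b; lia.
- by move=> a; apply: contraFF (iD a); apply: (subsetP sED).
- by move: eE hlt sS; clear; move: #|_| #|_| #|_| #|_| => a b c d; lia.
by exists E'; split=> //; apply: subset_trans sED.
Qed.

Lemma dcycle_induced D c (W : {set T}) : dcycle D c -> {subset c <= W} -> dcycle (induced D W) c.
Proof.
move=> /and3P[h1 h2 h3] hW; apply/and3P; split=> //.
case: c h1 h2 {h3} hW => // x c _ hp hW; apply: path_induced => // z.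
by rewrite inE mem_rcons => /predU1P[->|/hW//]; apply: hW; rewrite mem_head.
Qed.

(** This identifies the excess [#|D| - 2 * #|supp D|], the quantity tracked by the packing argument,
    with the number of branch vertices. *)
Lemma card_darts_cubic D : (forall x, deg D x != 1) -> (forall x, deg D x <= 3) ->
  #|D| = 2 * #|supp D| + #|branch D|.
Proof.
move=> d1 d3; rewrite card_darts -[#|supp D|]sum1_card -[#|branch D|]sum1_card.
rewrite big_distrr /= [X in X + _]big_mkcond [X in _ + X]big_mkcond -big_split /=.
apply: eq_bigr => x _; rewrite !inE; have := d1 x; have := d3 x; clear.
by move: (deg D x) => [|[|[|[|]]]].
Qed.

(** With [W] the vertices of the cycle and [b] its number of branch vertices, at most [2 * #|W| + b]
    darts start in [W], as many end there, and at least [2 * #|W|] do both. So at most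
    [2 * #|W| + 2 * b] darts are lost while the support shrinks by at least [#|W|]: the excess falls
    by at most [2 * b]. *)
Lemma cycle_removal D c : symmetric (drel D) -> (forall x, deg D x <= 3) -> dcycle D c ->
  #|D| + 2 * #|supp (induced D (~: [set x in c]))| <=
  #|induced D (~: [set x in c])| + 2 * #|supp D| + 2 * #|[set x in c] :&: branch D|.
Proof.
move=> sD d3 hc; set W := [set x in c]; set D' := induced D (~: W).
have cW : {subset c <= W} by move=> x xc; rewrite inE.
have eW : #|W| + #|supp D'| <= #|supp D|.
  rewrite -cardsUI (_ : W :&: supp D' = set0) ?cards0 ?addn0; last first.
    apply/setP=> x; rewrite in_setI in_set0; apply/negP=> /andP[xW /suppP[y]].
    by rewrite !inE /= -[x \in c](inE) xW andbF.
  apply/subset_leq_card; rewrite subUset supp_mono ?induced_sub // andbT.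
  apply/subsetP=> x; rewrite !inE => xc; have := dcycle_deg sD hc xc; lia.
pose A := [set d in D | d.1 \in W]; pose A' := [set d in D | d.2 \in W].
have eA : #|A| <= 2 * #|W| + #|W :&: branch D|.
  rewrite card_darts_from -[#|_ :&: _|]sum1_card -[#|W|]sum1_card big_distrr /=.
  have -> : \sum_(x in W :&: branch D) 1 = \sum_(x in W) (x \in branch D : nat).
    rewrite big_mkcond [RHS]big_mkcond; apply: eq_bigr => x _; rewrite in_setI.
    by case: (x \in W); case: (x \in branch D).
  rewrite -big_split /=; apply: leq_sum => x _; rewrite inE; have := d3 x; clear; case: eqP; lia.
have eA' : #|A'| = #|A|.
  have inj : injective (fun d : T * T => (d.2, d.1)) by move=> [a b] [a' b'] [-> ->].
  rewrite -(card_imset _ inj); apply: eq_card => -[a b]; rewrite inE /=; apply/imsetP/idP.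
    by case=> -[a' b']; rewrite inE /= => /andP[h1 h2] [-> ->]; rewrite h2 andbT; apply: dart_sym.
  by move=> /andP[h1 h2]; exists (b, a) => //; rewrite inE /= h2 andbT; apply: dart_sym.
have eI : 2 * #|W| <= #|A :&: A'|.
  have -> : A :&: A' = induced D W.
    by apply/setP=> d; rewrite !inE; case: (d \in D).
  rewrite card_darts -[#|W|]sum1_card big_distrr /= [leqRHS](bigID [in W]) /=.
  apply: leq_trans (leq_addr _ _); apply: leq_sum => x; rewrite inE => xc.
  exact: (dcycle_deg (induced_sym W sD) (dcycle_induced hc cW)).
have eD : #|D| = #|D'| + #|A :|: A'|.
  rewrite -(cardsID D' D) (setIidPr (induced_sub _ _)); congr (_ + _); apply: eq_card => d.
  by rewrite !inE; case: (d \in D); rewrite ?andbF //= !andbT negb_and !negbK.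
have := cardsUI A A'; rewrite eA' eD; move: eW eA eI; clear.
move: #|_| #|_| #|_| #|_| #|_| #|_| #|_| #|_| => a b c' d e f g h; lia.
Qed.

(** Pruning brings the excess below [2 ^ i] while keeping it at least [2 * (k * t)]. Then
    [few_branch_cycle] gives a cycle with at most [t] branch vertices, whose removal costs at most
    [2 * t] of the excess. *)
Lemma cubic_packing D k : symmetric (drel D) -> irreflexive (drel D) ->
  (forall x, deg D x <= 3) -> 2 * (k * t) + 2 <= 2 ^ i ->
  2 * #|supp D| + 2 * (k * t) <= #|D| ->
  exists C : 'I_k -> seq T, (forall i, dcycle D (C i)) /\
    (forall i j, i != j -> [disjoint C i & C j]).
Proof.
elim: k D => [|k IH] D sD iD d3 hi hm; first by exists (fun=> [::]); split=> -[].
have m0 : 0 < k.+1 * t by rewrite muln_gt0 /t addn3.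
have [E [sED sE dE /andP[hE1 hE2]]] := prune_excess m0 sD iD hm.
have iE : irreflexive (drel E).
  by move=> x; apply: contraFF (iD x); apply: (subsetP sED).
have dE3 x : deg E x <= 3 by apply: leq_trans (d3 x); apply: deg_mono.
have eE := card_darts_cubic dE dE3.
have [c hc bc] : exists2 c, dcycle E c & #|[set x in c] :&: branch E| <= t.
  apply: few_branch_cycle => //; move: hE1 hE2 eE m0 hi; clear.
  move: (k.+1 * t) (2 ^ i) #|_| #|_| #|_| => a b x y z; lia.
pose E' := induced E (~: [set x in c]).
have sE'D : E' \subset D by apply: subset_trans sED; apply: induced_sub.
have [|||||C [hC1 hC2]] := IH E'.
- exact: induced_sym.
- by move=> x; apply: contraFF (iD x); apply: (subsetP sE'D).
- by move=> x; apply: leq_trans (d3 x); apply: deg_mono.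
- by apply: leq_trans hi; rewrite leq_add2r leq_mul2l leq_mul2r leqnSn orbT.
- have := cycle_removal sE dE3 hc; rewrite -/E'; move: hE1 bc; rewrite [k.+1 * t]mulSn; clear.
  by move: #|_| #|_| #|_| #|_| #|_| (k * t) => a1 a2 a3 a4 a5 a6; lia.
exists (fun j => if unlift ord0 j is Some j' then C j' else c); split.
  by move=> j; case: unliftP => [j' _|_]; [apply: dcycle_mono (hC1 j') | apply: dcycle_mono hc].
have hcC j : [disjoint c & C j].
  apply/pred0P => z /=; apply/negbTE/negP=> /andP[zc zC].
  have := dcycle_deg (induced_sym _ sE) (hC1 j) zC; rewrite ltnNge => /negP; apply.
  rewrite /deg (_ : nb _ z = set0) ?cards0 //; apply/setP=> y; rewrite !inE /= zc.
  by rewrite andbF.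
move=> j j'; case: unliftP => [j1 ->|->]; case: unliftP => [j2 ->|->] //.
  by rewrite (inj_eq lift_inj); apply: hC2.
by move=> _; rewrite disjoint_sym; apply: hcC.
Qed.

End Packing.

(** * Attaching an ear *)

Section Ears.
Variable T : finType.
Implicit Types (D E : {set T * T}) (W : {set T}) (c p q r : seq T) (x y z v : T).

Definition edge2 x y : {set T * T} := [set (x, y); (y, x)].

Fixpoint pdarts x p : {set T * T} :=
  if p is y :: p' then edge2 x y :|: pdarts y p' else set0.

Lemma edge2E x y a b : ((a, b) \in edge2 x y) = (a == x) && (b == y) || (a == y) && (b == x).
Proof. by rewrite !inE !xpair_eqE. Qed.

Lemma setU_sym D E : symmetric (drel D) -> symmetric (drel E) -> symmetric (drel (D :|: E)).
Proof.
move=> sD sE x y; have h1 := sD x y; have h2 := sE x y.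
by move: h1 h2; rewrite /drel !in_setU => -> ->.
Qed.

Lemma edge2_sym x y : symmetric (drel (edge2 x y)).
Proof. by move=> a b; rewrite /drel !edge2E orbC ![(b == _) && _]andbC. Qed.

Lemma pdarts_sym x p : symmetric (drel (pdarts x p)).
Proof.
elim: p x => [|y p IH] x /=; first by move=> a b; rewrite /drel !inE.
by apply: setU_sym; [apply: edge2_sym | apply: IH].
Qed.

Lemma pdarts_rcons x p y : pdarts x (rcons p y) = pdarts x p :|: edge2 (last x p) y.
Proof. by elim: p x => [|z p IH] x /=; rewrite ?set0U ?setU0 // IH setUA. Qed.

Lemma pdarts_mem x p a b : (a, b) \in pdarts x p -> a \in x :: p /\ b \in x :: p.
Proof.
elim: p x => [|y p IH] x /=; first by rewrite inE.
rewrite in_setU edge2E => /orP[/orP[]/andP[/eqP-> /eqP->]|/IH[h1 h2]].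
- by rewrite !inE !eqxx !orbT.
- by rewrite !inE !eqxx !orbT.
- by rewrite in_cons h1 orbT in_cons h2 orbT.
Qed.

Lemma pdarts_edge (e : rel T) x p a b :
  symmetric e -> path e x p -> (a, b) \in pdarts x p -> e a b.
Proof.
move=> se; elim: p x => [|y p IH] x /=; first by rewrite inE.
move=> /andP[h1 h2]; rewrite in_setU edge2E => /orP[/orP[]/andP[/eqP-> /eqP->] //|].
  by rewrite se.
exact: IH.
Qed.

Lemma nbU D E v : nb (D :|: E) v = nb D v :|: nb E v.
Proof. by apply/setP=> w; rewrite !inE. Qed.

Lemma nb_supp0 D v : v \notin supp D -> nb D v = set0.
Proof. by rewrite inE lt0n negbK => /eqP /cards0_eq. Qed.

Lemma nb_pdarts0 x p v : v \notin x :: p -> nb (pdarts x p) v = set0.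
Proof.
move=> h; apply: nb_supp0; apply: contra h => /suppP[w] hw.
by case: (pdarts_mem hw).
Qed.

Lemma nb_edge2 x y v : x != y ->
  nb (edge2 x y) v = if v == x then [set y] else if v == y then [set x] else set0.
Proof.
move=> nxy; apply/setP=> w; rewrite inE edge2E.
case: (eqVneq v x) => [->|nx] /=; first by rewrite (negbTE nxy) orbF inE.
by case: eqVneq; rewrite inE.
Qed.

Lemma deg_pdarts x p v : uniq (x :: p) -> p != [::] -> v \in x :: p ->
  deg (pdarts x p) v = if (v == x) || (v == last x p) then 1 else 2.
Proof.
elim: p x => // y p IH x /=; rewrite negb_or => /andP[/andP[nxy xp] up] _ vp.
rewrite /deg nbU nb_edge2 //.
have [evx|nvx] := eqVneq v x.
  by rewrite evx nb_pdarts0 ?setU0 ?cards1 // inE negb_or nxy.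
move: vp; rewrite inE (negbTE nvx) /= => vp.
case: p IH xp up vp => [|z p] IH xp up vp.
  rewrite (_ : nb _ v = set0); last by apply/setP=> w; rewrite !inE.
  by move: vp; rewrite inE => ->; rewrite setU0 cards1.
have {}IH := IH y up isT vp; case: eqVneq IH => [->|nvy] /= IH.
  have -> : (y == last z p) = false.
    by apply/negbTE; case/andP: up => + _; apply: contra => /eqP {1}->; rewrite mem_last.
  rewrite cardsU -/(deg (pdarts y (z :: p)) y) IH cards1 (_ : _ :&: _ = set0) ?cards0 //.
  apply/setP=> w; rewrite in_setI in_set1 in_set0; apply/negbTE/negP=> /andP[/eqP->].
  rewrite in_set => h; case: (@pdarts_mem y (z :: p) _ _ h) => _; rewrite inE => /predU1P[e|]; last by apply/negP.
  by rewrite e eqxx in nxy.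
by rewrite set0U -/(deg (pdarts y (z :: p)) v) IH.
Qed.

Lemma pdarts_ends x p y : uniq (x :: rcons p y) -> (x, y) \in pdarts x (rcons p y) -> p = [::].
Proof.
case: p => // a p; rewrite rcons_cons => /andP[xp up] /=.
rewrite in_setU edge2E => /orP[|h]; last by case: (pdarts_mem h) => h'; rewrite h' in xp.
case/orP=> /andP[/eqP e1 /eqP e2].
  by case/andP: up => + _; rewrite -e2 mem_rcons mem_head.
by rewrite e1 mem_head in xp.
Qed.

Section AddPath.
Variables (D : {set T * T}).
Hypothesis sD : symmetric (drel D).

(** The last hypothesis excludes the degenerate ear that is already an edge of [D] and would add no
    degree. *)
Lemma deg_ear x p y v : irreflexive (drel D) ->
  uniq (x :: rcons p y) -> {in p, forall z, z \notin supp D} ->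
  p != [::] \/ (x, y) \notin D ->
  deg (D :|: pdarts x (rcons p y)) v =
    if v \in p then 2 else deg D v + ((v == x) || (v == y)).
Proof.
move=> iD up hp hxy; have nP : rcons p y != [::] by case: (p).
rewrite /deg nbU.
have [vp|nvp] := boolP (v \in p).
  rewrite nb_supp0 ?hp // set0U -/(deg _ v) deg_pdarts //; last by rewrite inE mem_rcons inE vp !orbT.
  rewrite last_rcons; case: eqVneq up => [<- /=|_ /=]; first by rewrite mem_rcons inE vp orbT.
  by case: eqVneq => //= <-; rewrite rcons_uniq vp andbF.
have [vxy|nvxy] := boolP ((v == x) || (v == y)); last first.
  rewrite nb_pdarts0 ?setU0 ?addn0 // inE mem_rcons inE !negb_or nvp.
  by move: nvxy; rewrite negb_or => /andP[-> ->].
have vx : v \in x :: rcons p y by rewrite inE mem_rcons inE orbA vxy.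
rewrite cardsU -/(deg (pdarts _ _) v) deg_pdarts // last_rcons vxy.
rewrite (_ : _ :&: _ = set0) ?cards0 ?subn0 //; apply/setP=> w.
rewrite in_setI in_set0; apply/negbTE/negP; rewrite !inE => /andP[vw vwP].
have nvw := dart_neq iD vw; have [_] := pdarts_mem vwP.
rewrite inE mem_rcons inE => /or3P[/eqP e|/eqP e|wp]; last first.
- by case/negP: (hp _ wp); apply: supp_dart (dart_sym sD vw).
- have ev : v = x by case/orP: vxy => /eqP // e'; rewrite e' e eqxx in nvw.
  rewrite ev e in vw vwP; have ep := pdarts_ends up vwP.
  by case: hxy => [|/negP]; rewrite ?ep.
- have ev : v = y by case/orP: vxy => /eqP // e'; rewrite e' e eqxx in nvw.
  rewrite ev e in vw vwP; have ep := pdarts_ends up (dart_sym (@pdarts_sym _ _) vwP).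
  by case: hxy => [|/negP]; rewrite ?ep //; apply; apply: dart_sym.
Qed.

(** Peel the pendant path off from its free end, which has degree 1 and so lies on no cycle. *)
Lemma pend_cycle x p c : uniq (x :: p) -> {in p, forall z, z \notin supp D} ->
  dcycle (D :|: pdarts x p) c -> dcycle D c.
Proof.
elim/last_ind: p => [|p a IH] up hp; first by rewrite setU0.
move=> hc; apply: IH.
- by move: up; rewrite -rcons_cons rcons_uniq => /andP[].
- by move=> z zp; apply: hp; rewrite mem_rcons inE zp orbT.
have ac : a \notin c.
  apply/negP=> /(dcycle_deg (setU_sym sD (@pdarts_sym _ _)) hc).
  rewrite /deg nbU nb_supp0 ?hp ?mem_rcons ?mem_head // set0U -/(deg _ a).
  rewrite deg_pdarts //; first by rewrite last_rcons eqxx orbT.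
  - by case: (p).
  - by rewrite inE mem_rcons mem_head orbT.
apply: dcycle_mono (dcycle_induced (W := ~: [set a]) hc _) => [|z zc]; last first.
  by rewrite !inE; apply: contraNneq ac => <-.
apply/subsetP=> -[z1 z2]; rewrite !inE pdarts_rcons in_setU edge2E /=.
case/and3P=> + n1 n2; rewrite (negbTE n1) (negbTE n2) /= andbF !orbF; by case: (_ \in D).
Qed.

(** A simple path that ends at the free end of a pendant path must have traversed all of it; this is
    seen by peeling off the last vertex. *)
Lemma pend_path x p y q : uniq (x :: p) -> {in p, forall z, z \notin supp D} ->
  path (drel (D :|: pdarts x p)) y q -> uniq (y :: q) -> y \notin p -> last y q = last x p ->
  exists r, [/\ path (drel D) y r, last y r = x & q = r ++ p].
Proof.
elim/last_ind: p q => [|p a IH] q up hp; first by rewrite setU0 => h1 _ _ h2; exists q; rewrite cats0.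
rewrite last_rcons; case/lastP: q => [|q b] hq uq yp /= ea.
  by rewrite ea mem_rcons mem_head in yp.
rewrite last_rcons in ea; subst b.
have aq : a \notin y :: q by move: uq; rewrite -rcons_cons rcons_uniq => /andP[].
have := hq; rewrite rcons_path => /andP[hq1 hq2].
have hq' : path (drel (D :|: pdarts x p)) y q.
  apply: path_mono (path_induced (W := ~: [set a]) hq1 _) => [|z zc]; last first.
    by rewrite !inE; apply: contraNneq aq => <-.
  apply/subsetP=> -[z1 z2]; rewrite !inE pdarts_rcons in_setU edge2E /=.
  case/and3P=> + n1 n2; rewrite (negbTE n1) (negbTE n2) /= andbF !orbF; by case: (_ \in D).
have ax : a \notin x :: p by move: up; rewrite -rcons_cons rcons_uniq => /andP[].
have el : last y q = last x p.
  move: hq2; rewrite /drel in_setU pdarts_rcons in_setU edge2E => /or4P[h|h|/andP[/eqP//]|/andP[/eqP e _]].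
  - by have := hp a; rewrite mem_rcons mem_head => /(_ isT) /negP[]; apply: supp_dart (dart_sym sD h).
  - by case: (pdarts_mem h) => _ h'; rewrite h' in ax.
  - by case/negP: aq; rewrite -e mem_last.
have [||||r [h1 h2 ->]] := IH q _ _ hq' _ _ el.
- by move: up; rewrite -rcons_cons rcons_uniq => /andP[].
- by move=> z zp; apply: hp; rewrite mem_rcons inE zp orbT.
- by move: uq; rewrite -rcons_cons rcons_uniq => /andP[].
- by apply: contra yp => yp; rewrite mem_rcons inE yp orbT.
by exists r; rewrite rcons_cat.
Qed.

(** View the ear as a pendant path followed by its last edge. A cycle without that edge lies in [D]
    by [pend_cycle]; any other one is cut open at the edge, and [pend_path] describes what
    remains. *)
Lemma ear_cycle x p y c : uniq (x :: rcons p y) -> {in p, forall z, z \notin supp D} ->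
  dcycle (D :|: pdarts x (rcons p y)) c ->
  dcycle D c \/ exists r, [/\ path (drel D) y r, last y r = x, uniq (y :: r),
     {subset p ++ y :: r <= c} & size c = size p + (size r).+1].
Proof.
move=> up hp hc; set E1 := D :|: pdarts x p; set a := last x p.
have eE : D :|: pdarts x (rcons p y) = E1 :|: edge2 a y by rewrite pdarts_rcons setUA.
have sE : symmetric (drel (D :|: pdarts x (rcons p y))).
  by apply: setU_sym => //; apply: pdarts_sym.
have up' : uniq (x :: p) by move: up; rewrite -rcons_cons rcons_uniq => /andP[].
have yp : y \notin x :: p by move: up; rewrite -rcons_cons rcons_uniq => /andP[].
(* The case of a cycle that runs through the last edge from [a] to [y]; the opposite direction is
   reduced to it by reversal. *)
have key c' : dcycle (D :|: pdarts x (rcons p y)) c' -> a \in c' -> next c' a = y ->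
    exists r, [/\ path (drel D) y r, last y r = x, uniq (y :: r),
     {subset p ++ y :: r <= c'} & size c' = size p + (size r).+1].
  move=> hc' ac' ny; have uc' : uniq c' by case/and3P: hc'.
  case/rot_to: ac' => i q eq; have := ny; rewrite -(next_rot i uc') eq.
  have := hc'; rewrite -(dcycle_rot _ i) eq; case: q eq => [|b q] eq; first by case/and3P.
  rewrite /= eqxx => hq eb; subst b; case/and3P: hq => sq /= /andP[_ hq] uq.
  have := uq; rewrite !inE negb_or => /and3P[/andP[nay aq] yq uq'].
  have := hq; rewrite rcons_path => /andP[hq1 hq2].
  have [r [h1 h2 h3]] : exists r, [/\ path (drel D) y r, last y r = x & rcons q a = r ++ p].
    apply: (pend_path up' hp); rewrite ?last_rcons //.
    - rewrite rcons_path; apply/andP; split.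
        apply: path_mono (path_induced (W := ~: [set a]) hq1 _) => [|z zc]; last first.
          rewrite !inE; apply: contraTneq zc => ->; by rewrite inE negb_or nay.
        apply/subsetP=> -[z1 z2]; rewrite in_set eE in_setU edge2E !in_setC !in_set1 /=.
        by case/and3P=> + n1 n2; rewrite (negbTE n1) (negbTE n2) /= andbF !orbF.
      move: hq2; rewrite {1}/drel eE in_setU edge2E => /orP[//|/orP[]/andP[/eqP e1 /eqP e2]].
        by rewrite e2 eqxx in nay.
      case: q sq yq e1 {eq hq uq aq uq' hq1} => //= b q _ + e1.
      by rewrite -e1 mem_last.
    - by rewrite cons_uniq mem_rcons inE negb_or eq_sym nay yq rcons_uniq aq.
    - by move: yp; rewrite inE negb_or => /andP[].
  have ur : uniq (y :: r ++ p) by rewrite -h3 cons_uniq mem_rcons inE negb_or eq_sym nay yq rcons_uniq aq.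
  exists r; split=> //.
  - by move: ur; rewrite -cat_cons cat_uniq => /and3P[].
  - move=> z; rewrite -[z \in c'](mem_rot i) eq mem_cat orbC -mem_cat cat_cons -h3.
    by rewrite !inE mem_rcons inE orbCA.
  - rewrite -(size_rot i) eq /=; have := congr1 size h3; rewrite size_rcons size_cat => ->.
    by rewrite addnS addnC.
have [all1|] := boolP (all (fun z => (z, next c z) \in E1) c).
  left; apply: (pend_cycle up' hp); case/and3P: hc => h1 h2 h3; apply/and3P; split=> //.
  by apply: cycle_from_next => // z zc; apply: (allP all1).
case/allPn=> z zc nz; right; case: (dcycle_nbrs sE hc zc) => + _ _.
rewrite eE in_setU (negbTE nz) /= edge2E => /orP[]/andP[/eqP e1 /eqP e2].
  by apply: key => //; rewrite -e1.
have uc : uniq c by case/and3P: hc.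
have [|||r [h1 h2 h3 h4 h5]] := key (rev c) _ _ _.
- by rewrite dcycle_rev.
- by rewrite mem_rev -e2 mem_next.
- by rewrite next_rev // -e2 prev_next.
by exists r; split=> //; [move=> w /h4; rewrite mem_rev | rewrite -h5 size_rev].
Qed.

End AddPath.
End Ears.

(** * Maximal subcubic subgraphs with only long cycles *)

Section Valid.
Variables (T : finType) (e : rel T) (S : {set T}) (l : nat).
Hypotheses (se : symmetric e) (ie : irreflexive e).
Implicit Types (D E : {set T * T}) (c p q r : seq T) (x y z v : T).

Definition good c := (l <= size c) && has [in S] c.

(** Vertices outside the subgraph have degree 0, so the degree condition allows 0, 2 and 3. *)
Record valid D : Prop := Valid {
  valid_sym : symmetric (drel D);
  valid_edge : forall x y, (x, y) \in D -> e x y;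
  valid_deg : forall x, (deg D x <= 3) && (deg D x != 1);
  valid_good : forall c, dcycle D c -> good c }.

Definition maximal D := [/\ valid D,
  forall E, valid E -> #|branch E| <= #|branch D| &
  forall E, valid E -> #|branch D| <= #|branch E| -> #|S :&: supp E| <= #|S :&: supp D|].

Lemma edge_irrefl_darts D : (forall x y, (x, y) \in D -> e x y) -> irreflexive (drel D).
Proof. by move=> h x; apply: contraFF (ie x); apply: h. Qed.

Lemma exists_maximal : exists D, maximal D.
Proof.
have v0 : valid set0.
  have d0 x : deg (set0 : {set T * T}) x = 0.
    by apply/eqP; rewrite cards_eq0; apply/eqP/setP=> y; rewrite !inE.
  split.
  - by move=> x y; rewrite /drel !inE.
  - by move=> x y; rewrite inE.
  - by move=> x; rewrite d0.
  - case=> [|x c] /and3P[] // _ h _.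
    have sy : symmetric (drel (set0 : {set T * T})) by move=> a b; rewrite /drel !inE.
    by move: h => /=; case: (rcons c x) (size_rcons c x) => // a s _ /andP[]; rewrite /drel inE.
(* The second term is at most [#|T|], so this weight orders lexicographically. *)
pose f D := #|branch D| * #|T|.+1 + #|S :&: supp D|.
have [D vD hD] := @ex_maximal _ valid f _ v0; exists D; split=> // E vE.
  have := hD _ vE; rewrite /f => h.
  rewrite leqNgt; apply/negP=> h'.
  have h1 : #|S :&: supp D| <= #|T| := max_card _.
  move: h h1 h'; clear; move: #|_| #|_| #|_| #|_| #|_| => a b c d t; nia.
by move=> h; have := hD _ vE; rewrite /f; move: h; clear; move: #|_| #|_| #|_| #|_| #|_| => a b c d t; nia.
Qed.

(** By [ear_cycle], a new cycle consists of the ear and a simple path of [D] from [y] to [x]. The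
    degree condition is imposed on the sum only, so that the ear may complete ends that have degree
    1 in [D]. *)
Lemma valid_ear D x p y : symmetric (drel D) -> (forall x y, (x, y) \in D -> e x y) ->
  (forall c, dcycle D c -> good c) ->
  path e x (rcons p y) -> uniq (x :: rcons p y) -> {in p, forall z, z \notin supp D} ->
  p != [::] \/ (x, y) \notin D ->
  (forall v, v \notin p -> let d := deg D v + ((v == x) || (v == y)) in (d <= 3) && (d != 1)) ->
  (forall r, path (drel D) y r -> last y r = x -> uniq (y :: r) ->
     (l <= size p + (size r).+1) && has [in S] (p ++ y :: r)) ->
  valid (D :|: pdarts x (rcons p y)).
Proof.
move=> sD De Dg hp up hps hxy hd hr; split.
- by apply: setU_sym => //; apply: pdarts_sym.
- by move=> a b; rewrite in_setU => /orP[/De //|]; apply: pdarts_edge.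
- move=> v; rewrite deg_ear //; last exact: edge_irrefl_darts.
  by have := hd v; case: (v \in p) => //=; apply.
- move=> c hc; case: (ear_cycle sD up hps hc) => [|]; first exact: Dg.
  case=> r [h1 h2 h3 h4 h5]; have /andP[h6 h7] := hr r h1 h2 h3.
  rewrite /good h5 h6 /=; case/hasP: h7 => z zr zS; apply/hasP; exists z => //; exact: h4.
Qed.

Variable D : {set T * T}.
Hypothesis maxD : maximal D.

Let vD : valid D. Proof. by case: maxD. Qed.
Let sD : symmetric (drel D) := valid_sym vD.
Let iD : irreflexive (drel D) := edge_irrefl_darts (valid_edge vD).

(** Otherwise the ear could be added to [D] with [x] and [y] as further branch vertices, against the
    maximal number of these. *)
Lemma ear_blocked x p y : deg D x = 2 -> deg D y = 2 ->
  path e x (rcons p y) -> uniq (x :: rcons p y) -> {in p, forall z, z \notin supp D} ->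
  p != [::] \/ (x, y) \notin D ->
  exists r, [/\ path (drel D) y r, last y r = x &
    size r < l \/ ~~ has [in S] (p ++ y :: r)].
Proof.
move=> dx dy hp up hps hxy; apply: contrapT => hn.
have vE : valid (D :|: pdarts x (rcons p y)).
  apply: valid_ear => //.
  - exact: (valid_edge vD).
  - exact: (valid_good vD).
  - move=> v vp /=; have [->|_] := eqVneq v x; first by rewrite dx.
    have [->|_] := eqVneq v y; first by rewrite dy.
    by rewrite addn0; apply: valid_deg.
  move=> r h1 h2 h3; apply: contraT => h; case: hn; exists r; split=> //.
  move: h; rewrite negb_and -ltnNge => /orP[h|]; [left|by right].
  by move: h; clear; lia.
have xp : x \notin p by move: up; rewrite /= mem_rcons inE negb_or -andbA => /and3P[].
have : branch D \proper branch (D :|: pdarts x (rcons p y)).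
  apply/properP; split.
    apply/subsetP=> v; rewrite !inE => /eqP dv; rewrite deg_ear //.
    have -> : v \in p = false.
      by apply: contraTF isT => /hps; rewrite inE dv.
    have [e1|_] := eqVneq v x; first by rewrite e1 dx in dv.
    have [e1|_] := eqVneq v y; first by rewrite e1 dy in dv.
    by rewrite dv.
  exists x; last by rewrite inE dx.
  by rewrite inE deg_ear // (negbTE xp) dx eqxx.
by move/proper_card; rewrite ltnNge; case: maxD => _ -> //.
Qed.

(** A good cycle disjoint from [D] could be added to it as a new component, keeping all branch
    vertices and covering more of [S]. *)
Lemma good_cycle_meets c : 2 < size c -> cycle e c -> uniq c -> good c ->
  has [in supp D] c.
Proof.
move=> sc cc uc gc; apply: contraT => /hasPn hn.
case: c sc cc uc gc hn => [//|x q]; case/lastP: q => [//|q y] sq cc uc gc hn.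
have qn : q != [::] by case: q sq {cc uc gc hn}.
have hp : path e x (rcons q y) by move: cc; rewrite /= rcons_path => /andP[].
have eyx : e y x by move: cc; rewrite /= rcons_path last_rcons => /andP[].
have nyx : y != x by apply: contraTneq eyx => ->; rewrite ie.
have xs : x \notin supp D by apply: hn; rewrite mem_head.
have ys : y \notin supp D by apply: hn; rewrite inE mem_rcons mem_head orbT.
have qxy z : z \in q -> z != x /\ z != y.
  move=> zq; split; apply: contraTneq zq => ->.
    by move: uc; rewrite /= mem_rcons inE negb_or -andbA => /and3P[].
  by move: uc; rewrite /= rcons_uniq => /and3P[].
(* The cycle is added in two steps, one edge first and the rest as an ear at that edge, so
   that [valid_ear] applies. *)
pose D1 := D :|: edge2 y x.
have sD1 : symmetric (drel D1) by apply: setU_sym => //; apply: edge2_sym.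
have eD1 a b : (a, b) \in D1 -> e a b.
  rewrite in_setU edge2E => /orP[/(valid_edge vD) //|].
  by case/orP=> /andP[/eqP-> /eqP->] //; rewrite se.
have d1 v : v \in x :: rcons q y -> deg D1 v = (v == y) || (v == x).
  move=> /hn hv; rewrite /deg nbU (nb_supp0 hv) set0U nb_edge2 //.
  by case: eqP => _; [|case: eqP => _]; rewrite /= ?cards1 ?cards0.
have d1' v : v \notin x :: rcons q y -> deg D1 v = deg D v.
  rewrite inE mem_rcons inE !negb_or => /and3P[nx ny _].
  by rewrite /deg nbU nb_edge2 // (negbTE nx) (negbTE ny) setU0.
have qs1 : {in q, forall z, z \notin supp D1}.
  move=> z zq; rewrite inE d1 ?inE ?mem_rcons ?inE ?zq ?orbT //.
  by have [h1 h2] := qxy _ zq; rewrite (negbTE h1) (negbTE h2).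
have vE : valid (D1 :|: pdarts x (rcons q y)).
  apply: valid_ear => //.
  - move=> c hc; apply: (valid_good vD); apply: (@pend_cycle _ _ sD y [:: x]) => /=.
    + by rewrite inE nyx.
    + by move=> z; rewrite inE => /eqP->.
    + by rewrite setU0.
  - by left.
  - move=> v vq /=; have [vin|vout] := boolP (v \in x :: rcons q y).
      move: (vin); rewrite inE mem_rcons inE (negbTE vq) orbF => h.
      by rewrite d1 // h orbC h.
    rewrite d1' //; move: vout; rewrite inE mem_rcons inE !negb_or => /and3P[/negbTE-> /negbTE-> _].
    by rewrite addn0; apply: valid_deg.
  move=> r h1 h2 h3; have xr : x \in y :: r by rewrite -h2 mem_last.
  have sub : {subset x :: rcons q y <= q ++ y :: r}.
    move=> z; rewrite inE mem_rcons inE mem_cat => /or3P[/eqP->|/eqP->|->//].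
      by rewrite xr orbT.
    by rewrite mem_head orbT.
  have := gc; rewrite /good => /andP[g1 g2]; apply/andP; split.
    apply: leq_trans g1 _; have := uniq_leq_size uc sub.
    by rewrite size_cat.
  by case/hasP: g2 => z zc zS; apply/hasP; exists z => //; apply: sub.
have iD1 := edge_irrefl_darts eD1.
have dE v : v \in supp D -> deg (D1 :|: pdarts x (rcons q y)) v = deg D v.
  move=> vs; have vout : v \notin x :: rcons q y by apply: contraL vs => /hn.
  rewrite deg_ear // ?d1' //; last by left.
  move: vout; rewrite inE mem_rcons inE !negb_or => /and3P[/negbTE-> /negbTE-> /negbTE->].
  by rewrite addn0.
have hb : #|branch D| <= #|branch (D1 :|: pdarts x (rcons q y))|.
  apply/subset_leq_card/subsetP=> v; rewrite !inE => /eqP dv.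
  by rewrite dE ?dv // inE dv.
have [_ _ /(_ _ vE hb)] := maxD; rewrite leqNgt => /negP[].
apply/proper_card/properP; split.
  apply/subsetP=> v; rewrite !in_setI => /andP[-> vs] /=.
  by rewrite inE dE //; move: vs; rewrite inE.
case/andP: gc => _ /hasP[z zc zS]; exists z; last by rewrite in_setI negb_and (hn _ zc) orbT.
rewrite in_setI zS inE deg_ear //; last by left.
move: (zc); rewrite inE mem_rcons inE; case: (z \in q) => //; rewrite orbF => h.
by rewrite d1 // h orbC h.
Qed.

End Valid.

(** * Long cycles outside the core *)

Lemma ex_minimal (A : Type) (P : A -> Prop) (f : A -> nat) a :
  P a -> exists2 b, P b & forall c, P c -> f b <= f c.
Proof.
have [n] := ubnP (f a); elim: n a => // n IH a; rewrite ltnS => hn Pa.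
have [[c Pc lc]|none] := EM (exists2 c, P c & f c < f a).
  by apply: IH Pc; apply: leq_trans hn.
by exists a => // c Pc; rewrite leqNgt; apply/negP=> lc; apply: none; exists c.
Qed.

Section Frame.
Variables (T : finType) (e : rel T) (S : {set T}) (l : nat).
Hypotheses (se : symmetric e) (ie : irreflexive e).
Variable D : {set T * T}.
Hypothesis maxD : maximal e S l D.
Variable U : {set T}.
Hypothesis bU : branch D \subset U.
Let F := induced D (~: U).
Variable N : T -> nat.
Hypothesis numN : numbering F N.
Implicit Types (c p q r : seq T) (x y z v b s : T).

Let vD : valid e S l D. Proof. by case: maxD. Qed.
Let sD : symmetric (drel D) := valid_sym vD.
Let iD : irreflexive (drel D) := edge_irrefl_darts ie (valid_edge vD).
Let sF : symmetric (drel F) := induced_sym _ sD.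
Let cF : connect_sym (drel F) := sym_connect_sym sF.

Notation Fconn := (connect (drel F)).
Notation dist := (ndist N).
Notation between := (nbetween N).

Definition border := [set b | (b \notin U) && [exists u in U, (u, b) \in D]].
(** The default [b], for a path of [F] without vertices of [S], adds nothing to [core], which
    contains the ball around [b] anyway. *)
Definition first_S b :=
  if [pick s in S | Fconn b s] is Some s0 then [arg min_(s < s0 | (s \in S) && Fconn b s) dist b s]
  else b.
Definition core := U :|: \bigcup_(b in border) (ball F N l b :|: ball F N l (first_S b)).
(* A border vertex is an end of its path in [F], so this says that the stretch of [F] from
   [b] to [x] avoids [S]. *)
Definition outer x := exists2 b, b \in border &
  Fconn b x /\ forall v, v \in S -> Fconn b v -> dist b x < dist b v.

Lemma FE x y : ((x, y) \in F) = [&& (x, y) \in D, x \notin U & y \notin U].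
Proof. by rewrite !inE. Qed.

Lemma Fsub : F \subset D. Proof. exact: induced_sub. Qed.

Lemma card_border : #|border| <= 3 * #|U|.
Proof.
apply: (@leq_trans #|[set d.2 | d in [set d in D | d.1 \in U]]|).
  apply/subset_leq_card/subsetP=> b; rewrite inE => /andP[_ /exists_inP[u uU ub]].
  by apply/imsetP; exists (u, b); rewrite ?inE ?ub.
apply: leq_trans (leq_imset_card _ _) _; rewrite card_darts_from mulnC -sum_nat_const.
by apply: leq_sum => x _; case/andP: (valid_deg vD x).
Qed.

(** There are at most [3 * #|U|] border vertices with two balls of at most [2 * l + 1] vertices
    each, and [3 * (4 * l + 2) + 1 = 12 * l + 7]. *)
Lemma card_core : #|core| <= #|U| * (12 * l + 7).
Proof.
have hb : #|\bigcup_(b in border) (ball F N l b :|: ball F N l (first_S b))| <= #|border| * (4 * l + 2).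
  rewrite -sum_nat_const; elim/big_rec2: _ => [|b n A _ IH]; first by rewrite cards0.
  apply: leq_trans (leq_card_setU _ _) _; apply: leq_add => //.
  apply: leq_trans (leq_card_setU _ _) _.
  have := card_ball numN sF l b; have := card_ball numN sF l (first_S b); clear.
  by move: #|_| #|_| => m1 m2; lia.
apply: leq_trans (leq_card_setU _ _) _; move: hb card_border; clear.
by move: #|_| #|_| #|_| => a b c; nia.
Qed.

Lemma core_U x : x \notin core -> x \notin U.
Proof. by apply: contra; rewrite inE => ->. Qed.

Lemma core_ball b x : b \in border -> x \notin core ->
  (x \notin ball F N l b) && (x \notin ball F N l (first_S b)).
Proof.
move=> hb; rewrite !inE negb_or => /andP[_]; apply: contraR; rewrite negb_and !negbK => h.
by apply/bigcupP; exists b => //; rewrite !inE.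
Qed.

Lemma ballE z x : x \in ball F N l z = Fconn z x && (dist z x <= l).
Proof. by rewrite inE -andbA; congr (_ && _); rewrite /ndist; lia. Qed.

Lemma first_SP b v : v \in S -> Fconn b v ->
  [/\ first_S b \in S, Fconn b (first_S b) & forall w, w \in S -> Fconn b w -> dist b (first_S b) <= dist b w].
Proof.
move=> vS cv; rewrite /first_S; case: pickP => [s0 h0|/(_ v)]; last by rewrite /= vS cv.
have h0' : (s0 \in S) && Fconn b s0 by move: h0.
case: (arg_minnP (P := fun s => (s \in S) && Fconn b s) (dist b) h0') => s /andP[h1 h2] h3; split=> // w wS cw.
by apply: h3; rewrite wS.
Qed.

Lemma notU_deg x : x \notin U -> deg D x <= 2.
Proof.
move=> xU; have /andP[h1 h2] := valid_deg vD x.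
have : deg D x != 3 by apply: contra xU => h; apply: (subsetP bU); rewrite inE.
by move: h1 h2; lia.
Qed.

(** Outside [U] degrees are at most 2, and one of the neighbours of [b] lies in [U]. *)
Lemma border_deg b : b \in border -> deg F b <= 1.
Proof.
rewrite inE => /andP[bnU /exists_inP[u uU ub]].
rewrite -ltnS; apply: leq_trans (notU_deg bnU); apply/proper_card/properP; split.
  by apply/subsetP=> y; rewrite !inE => /and3P[].
exists u; rewrite inE; first exact: dart_sym.
by rewrite FE uU !andbF.
Qed.

Lemma border_side b x y : b \in border -> Fconn b x -> Fconn b y ->
  (N b <= N x) && (N b <= N y) || (N x <= N b) && (N y <= N b).
Proof. by move=> /border_deg; apply: end_one_sided. Qed.

(** Seen from [b], the vertex [first_S b] comes after [x] and not after [v]. It would thus lie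
    within distance [l] of [x], which would put [x] into the core. *)
Lemma outer_no_near_S x y v : x \notin core -> outer x -> Fconn x y -> dist x y <= l ->
  v \in S -> Fconn x v -> between x y v -> False.
Proof.
move=> xc [b hb [cbx hx]] cxy dxy vS cxv bv.
have cbv := connect_trans cbx cxv.
have [sS cs hs] := first_SP vS cbv.
have /andP[_] := core_ball hb xc; rewrite ballE negb_and.
rewrite (connect_trans _ cbx) 1?cF //= => /negP; apply.
have h1 := hs _ vS cbv; have h2 := hx _ sS cs.
have := border_side hb cbx cs; have := border_side hb cbx (connect_trans cbx cxy).
move: h1 h2 bv dxy; rewrite /ndist /nbetween; clear.
move: (N x) (N y) (N v) (N b) (N (first_S b)) => nx ny nv nb' ns h1 h2 bv dxy.
by case/orP=> /andP[h3 h4]; case/orP=> /andP[h5 h6]; case/orP: bv => /andP[h7 h8]; lia.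
Qed.

Lemma exit x p : path (drel D) x p -> x \notin U -> has [in U] p ->
  exists p1 u p2, [/\ p = p1 ++ u :: p2, path (drel F) x p1, u \in U & last x p1 \in border].
Proof.
elim: p x => //= y p IH x /andP[xy hp] xU.
have [yU _|yU /= h] := boolP (y \in U).
  exists [::], y, p; split=> //=; rewrite inE xU; apply/exists_inP; exists y => //.
  exact: dart_sym.
have [p1 [u [p2 [-> h1 h2 h3]]]] := IH y hp yU h.
exists (y :: p1), u, p2; split=> //=; rewrite h1 andbT /drel FE xU yU.
by rewrite -[_ \in D]/(drel D x y) xy.
Qed.

Lemma no_exit x p : path (drel D) x p -> x \notin U -> ~~ has [in U] p -> path (drel F) x p.
Proof.
move=> hp xU hU; apply: path_induced => // z; rewrite !inE => /predU1P[->//|zp].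
by apply: contra hU => zU; apply/hasP; exists z.
Qed.

(** Before entering [U] the path reaches a border vertex, and the core contains the [l]-ball around
    it. *)
Lemma far_exit x p : x \notin core -> path (drel D) x p -> has [in U] p -> l < size p.
Proof.
move=> xc hp h; have [p1 [u [p2 [-> h1 h2 h3]]]] := exit hp (core_U xc) h.
have /andP[+ _] := core_ball h3 xc; rewrite ballE cF.
have -> : Fconn x (last x p1) by apply/connectP; exists p1.
have := dist_path numN h1; rewrite size_cat /= /ndist; lia.
Qed.

Lemma outer_intro x p : path (drel F) x p -> last x p \in border ->
  {in x :: p, forall z, z \notin S} -> outer x.
Proof.
move=> hp hb hS; exists (last x p) => //.
have cb : Fconn (last x p) x by rewrite cF; apply/connectP; exists p.
split=> // v vS cv; rewrite ltnNge; apply/negP=> h.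
have : v \in x :: p; last by move/hS; rewrite vS.
apply: (path_between numN sF hp) => //; first by apply: connect_trans cv; rewrite cF.
have := border_side hb cb cv; move: h; rewrite /ndist /nbetween; clear.
by move: (N x) (N v) (N _) => nx nv nb' h; case/orP=> /andP[h3 h4]; lia.
Qed.

(** * Connection in [D - S] and rerouting of segments *)

Definition Sconn := connect (drel (induced D (~: S))).

Lemma Sconn_sym : connect_sym (drel (induced D (~: S))).
Proof. by apply/sym_connect_sym/induced_sym. Qed.

(** If the walk enters [U], its part before that is a stretch of [F] without [S] up to a border
    vertex; otherwise all of it stays in [F]. *)
Lemma Sconn_cases x y : x \notin U -> x \notin S -> Sconn x y ->
  outer x \/ exists2 p, path (drel F) x p /\ last x p = y & {in x :: p, forall z, z \notin S}.
Proof.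
move=> xU xS /connectP[p hp ey]; have [hpD hpS] := induced_path hp.
have hS : {in x :: p, forall z, z \notin S}.
  by move=> z; rewrite inE => /predU1P[->//|/hpS]; rewrite inE.
have [h|h] := boolP (has [in U] p); last by right; exists p => //; split=> //; apply: no_exit.
left; have [p1 [u [p2 [ep h1 h2 h3]]]] := exit hpD xU h.
apply: (outer_intro h1 h3) => z zp; apply: hS; rewrite ep -cat_cons mem_cat zp //.
Qed.

Lemma Sconn_S x y : Sconn x y -> x \notin S -> y \notin S.
Proof.
move=> /connectP[p hp ->] xS; have [_ hpS] := induced_path hp.
by have := mem_last x p; rewrite inE => /predU1P[->//|/hpS]; rewrite inE.
Qed.

(** Unless [y] is outer at once, [Sconn_cases] gives a stretch of [F] without [S] from [y] to [x],
    so the border vertex that serves [x] also serves [y]. *)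
Lemma Sconn_outer x y : x \notin U -> y \notin U -> x \notin S -> Sconn x y -> outer x -> outer y.
Proof.
move=> xU yU xS cxy ox; have yS := Sconn_S cxy xS.
have cyx : Sconn y x by rewrite /Sconn Sconn_sym.
have [//|[p [hp el] hS]] := Sconn_cases yU yS cyx.
case: ox => b hb [cbx hx]; exists b => //.
have cyx' : Fconn y x by apply/connectP; exists p.
have cby : Fconn b y by apply: connect_trans cbx _; rewrite cF.
split=> // v vS cv; rewrite ltnNge; apply/negP=> h.
have : v \in y :: p; last by move/hS; rewrite vS.
apply: (path_between numN sF hp) => //; first by apply: connect_trans cv; rewrite cF.
rewrite el; have h1 := hx _ vS cv.
have := border_side hb cv cby; have := border_side hb cbx cv.
move: h h1; rewrite /ndist /nbetween; clear.
move: (N x) (N y) (N v) (N b) => nx ny nv nb' h h1.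
by case/orP=> /andP[h3 h4]; case/orP=> /andP[h5 h6]; lia.
Qed.

Lemma Sconn_inner x y : x \notin U -> x \notin S -> Sconn x y -> ~ outer x ->
  Fconn x y /\ forall v, v \in S -> Fconn x v -> ~~ between x y v.
Proof.
move=> xU xS cxy ox; have [//|[p [hp el] hS]] := Sconn_cases xU xS cxy.
split; first by apply/connectP; exists p.
move=> v vS cv; apply/negP=> h; have : v \in x :: p; last by move/hS; rewrite vS.
by apply: (path_between numN sF hp) => //; rewrite el.
Qed.

Lemma Fconn_notU x w : x \notin U -> Fconn x w -> w \notin U.
Proof.
move=> xU /connectP[p hp ->]; have [_ h] := induced_path hp.
by have := mem_last x p; rewrite inE => /predU1P[->//|/h]; rewrite inE.
Qed.

(* If the segment of [F] between [x] and [y] misses [S], swapping it for a path that meets [S]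
   keeps every cycle good, since a cycle through the new path still has to run from [x] to [U];
   this contradicts the choice of [D]. *)
Lemma no_reroute x y p : x \notin core -> y \notin core -> Fconn x y -> N x < N y ->
  (forall v, v \in S -> Fconn x v -> ~~ between x y v) ->
  path e x (rcons p y) -> uniq (x :: rcons p y) -> {in p, forall z, z \notin supp D} ->
  ~~ has [in S] p.
Proof.
move=> xc yc cxy lxy hS hp up hps; apply/negP=> pS.
have xU := core_U xc; have yU := core_U yc.
pose I := [set v | Fconn x v && (N x < N v < N y)].
(* When [x] and [y] are adjacent in [F], the interior [I] is empty and the segment to delete is the
   edge [x y] itself; hence the [edge2] clause. *)
pose D0 := [set d in D | [&& d.1 \notin I, d.2 \notin I & d \notin edge2 x y]].
have D0E a b : ((a, b) \in D0) = [&& (a, b) \in D, a \notin I, b \notin I & (a, b) \notin edge2 x y].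
  by rewrite in_set.
have D0D : D0 \subset D by apply/subsetP=> d; rewrite in_set => /andP[].
have sD0 : symmetric (drel D0).
  move=> a b; have h1 := sD a b; have h2 := edge2_sym x y a b; rewrite /drel in h1 h2 *.
  by rewrite !D0E h1 h2; congr (_ && _); rewrite andbCA.
have xI : x \notin I by rewrite inE ltnn andbF.
have yI : y \notin I by rewrite inE ltnn !andbF.
have Dpos a b : (a, b) \in F -> deg D a = 2.
  rewrite FE => /and3P[ab aU _]; have := notU_deg aU; have /andP[_] := valid_deg vD a.
  have := supp_dart ab; rewrite inE; clear; lia.
have inI v : Fconn x v -> N x <= N v <= N y -> [\/ v \in I, v = x | v = y].
  move=> cv hv; have [e1|n1] := eqVneq (N v) (N x).
    by apply: Or32; apply: numN.2; rewrite // cF.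
  have [e2|n2] := eqVneq (N v) (N y).
    by apply: Or33; apply: numN.2 => //; apply: connect_trans cxy; rewrite cF.
  by apply: Or31; rewrite inE cv /=; move: n1 n2 hv; clear; lia.
have nbI v w : w \in I -> (v, w) \in D -> [\/ v \in I, v = x | v = y].
  rewrite inE => /andP[cw /andP[h1 h2]] vw.
  have cwy : Fconn w y by apply: connect_trans cxy; rewrite cF.
  have cwx : Fconn w x by rewrite cF.
  have [a wa ea] := connect_step numN sF cwy h2.
  have [b wb eb] := connect_step_down numN sF cwx h1.
  have nab : a != b by apply/eqP=> ab; move: ea eb; rewrite ab; clear; lia.
  have sub : [set a; b] \subset nb D w.
    by apply/subsetP=> z; rewrite !inE => /orP[]/eqP->; apply: (subsetP Fsub).
  have /eqP eab : [set a; b] == nb D w.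
    by rewrite eqEcard sub cards2 nab; apply: notU_deg; apply: Fconn_notU cw.
  have : v \in [set a; b] by rewrite eab inE; apply: dart_sym.
  rewrite in_set2 => /orP[]/eqP->; apply: inI.
  - by apply: connect_trans cw _; apply: connect1.
  - by move: ea h1 h2; clear; lia.
  - by apply: connect_trans cw _; apply: connect1.
  - by move: eb h1 h2; clear; lia.
(* Each end of the segment loses exactly one neighbour, the one towards the other end, and the new
   path makes up for it. *)
have hend a a' : a \notin I -> (a, a') \in F -> a' \in I \/ (a, a') \in edge2 x y ->
    (forall w, (a, w) \in D -> w \in I \/ (a, w) \in edge2 x y -> w = a') ->
    deg D0 a + 1 = deg D a.
  move=> aI aa' ha' hw; rewrite /deg [RHS](cardsD1 a') inE (subsetP Fsub _ aa') addnC.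
  congr (_ + _); apply: eq_card => w; rewrite in_setD1 !in_nb D0E.
  have [->|nwa'] /= := eqVneq w a'.
    by case: ha' => ->; rewrite ?andbF.
  case aw: ((a, w) \in D) => //=; rewrite aI /=.
  apply/andP; split; apply/negP=> h; case/eqP: nwa'; apply: hw => //; [by left|by right].
have hx : deg D0 x + 1 = deg D x.
  have [x' xx' ex'] := connect_step numN sF cxy lxy.
  have cx' : Fconn x x' by apply: connect1.
  have hx' : x' \in I \/ (x, x') \in edge2 x y.
    case: (inI x' cx' _) => [|h|h|h]; first by move: ex' lxy; clear; lia.
    - by left.
    - by move: ex'; rewrite h; clear; lia.
    - by right; rewrite edge2E h !eqxx.
  apply: hend xI xx' hx' _ => w xw h.
  have [cw lw] : Fconn x w /\ N x < N w.
    case: h => [|]; first by rewrite inE => /andP[-> /andP[]].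
    rewrite edge2E => /orP[]/andP[/eqP e1 /eqP e2]; first by rewrite e2.
    by move: lxy; rewrite -e1; clear; lia.
  have xw' : (x, w) \in F by rewrite FE xw xU; apply: Fconn_notU cw.
  apply: numN.2; first by apply: connect_trans cx'; rewrite cF.
  by move: (numN.1 _ _ xw') ex' lw; clear; lia.
have hy : deg D0 y + 1 = deg D y.
  have cyx : Fconn y x by rewrite cF.
  have [y' yy' ey'] := connect_step_down numN sF cyx lxy.
  have cy' : Fconn y y' by apply: connect1.
  have hy' : y' \in I \/ (y, y') \in edge2 x y.
    case: (inI y' (connect_trans cxy cy') _) => [|h|h|h]; first by move: ey' lxy; clear; lia.
    - by left.
    - by right; rewrite edge2E h !eqxx orbT.
    - by move: ey'; rewrite h; clear; lia.
  apply: hend yI yy' hy' _ => w yw h.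
  have [cw lw] : Fconn y w /\ N w < N y.
    case: h => [|]; first by rewrite inE => /andP[h1 /andP[_ h2]]; split=> //; apply: connect_trans h1.
    rewrite edge2E => /orP[]/andP[/eqP e1 /eqP e2]; last by rewrite e2.
    by move: lxy; rewrite -e1; clear; lia.
  have yw' : (y, w) \in F by rewrite FE yw yU; apply: Fconn_notU cw.
  apply: numN.2; first by apply: connect_trans cy'; rewrite cF.
  by move: (numN.1 _ _ yw') ey' lw; clear; lia.
have degD0 v : v \notin I -> deg D0 v + ((v == x) || (v == y)) = deg D v.
  move=> vI; have [->|nvx] := eqVneq v x; first exact: hx.
  have [->|nvy] := eqVneq v y; first exact: hy.
  rewrite addn0; apply: eq_card => w; rewrite !in_nb D0E vI edge2E (negbTE nvx) (negbTE nvy) andbT.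
  case vw: ((v, w) \in D) => //=; apply/negP=> /nbI /(_ vw)[]; [exact/negP | exact/eqP | exact/eqP].
have I0 v : v \in I -> deg D0 v = 0.
  move=> vI; apply/eqP; rewrite cards_eq0; apply/eqP/setP=> w.
  by rewrite in_nb D0E vI andbF in_set0.
have hps0 : {in p, forall z, z \notin supp D0}.
  by move=> z /hps; apply: contra; apply: (subsetP (supp_mono D0D)).
have pn : p != [::] by apply: contraTneq pS => ->.
have vE : valid e S l (D0 :|: pdarts x (rcons p y)).
  apply: valid_ear => //.
  - by move=> a b /(subsetP D0D); apply: (valid_edge vD).
  - by move=> c /(dcycle_mono D0D); apply: (valid_good vD).
  - by left.
  - move=> v vp; cbv zeta; have [vI|vI] := boolP (v \in I); last by rewrite degD0 //; apply: (valid_deg vD).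
    rewrite I0 // (_ : _ || _ = false) //; apply/negbTE/negP=> /orP[]/eqP e1.
      by rewrite e1 (negbTE xI) in vI.
    by rewrite e1 (negbTE yI) in vI.
  move=> r hr er ur; rewrite has_cat pS andbT.
  have hrD : path (drel D) y r by apply: path_mono hr.
  (* A simple path of [D0] from [y] to [x] cannot stay in [F]: going down from [y] is blocked by the
     deleted segment, and after going up it would have to pass [y] again. *)
  suff : has [in U] r by move/(far_exit yc hrD); clear; lia.
  apply: contraT => /(no_exit hrD yU) hrF.
  case: r hr er ur {hrD} hrF => [|z r] /=; first by move=> _ e1; move: lxy; rewrite e1 ltnn.
  move=> /andP[yz _] er /andP[yr _] /andP[yzF hrF].
  have cyz : Fconn y z by apply: connect1.
  move: yz; rewrite /drel D0E => /and4P[_ _ zI yzE].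
  case: (numN.1 _ _ yzF) => ez.
    case: (inI z (connect_trans cxy cyz) _) => [|h|h|h]; first by move: ez lxy; clear; lia.
    - by rewrite h in zI.
    - by rewrite edge2E h !eqxx orbT in yzE.
    - by move: ez; rewrite h; clear; lia.
  case/negP: yr; apply: (path_between numN sF hrF); first by rewrite cF.
  by rewrite er /nbetween; move: ez lxy; clear; lia.
have iD0 : irreflexive (drel D0) by move=> a; apply: contraFF (iD a); apply: (subsetP D0D).
have dE v : deg (D0 :|: pdarts x (rcons p y)) v = if v \in p then 2 else if v \in I then 0 else deg D v.
  rewrite deg_ear //; last by left.
  case: (v \in p) => //; case: ifP => vI; last by rewrite degD0 ?vI.
  rewrite I0 // (_ : _ || _ = false) //; apply/negbTE/negP=> /orP[]/eqP e1.
    by rewrite e1 (negbTE xI) in vI.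
  by rewrite e1 (negbTE yI) in vI.
have pD v : v \in supp D -> v \in p = false by move=> vs; apply: contraTF vs => /hps.
have hb : #|branch D| <= #|branch (D0 :|: pdarts x (rcons p y))|.
  apply/subset_leq_card/subsetP=> v vb; have vU := subsetP bU _ vb.
  move: vb; rewrite !inE => /eqP dv; rewrite dE pD; last by rewrite inE dv.
  rewrite (_ : v \in I = false) ?dv //; apply: contraTF vU; rewrite inE => /andP[cv _].
  exact: Fconn_notU cv.
have [_ _ /(_ _ vE hb)] := maxD; rewrite leqNgt => /negP[].
(* Only the interior of the segment leaves the support, and it has no vertex of [S], while one on
   [p] is gained. *)
apply/proper_card/properP; split.
  apply/subsetP=> v; rewrite !in_setI => /andP[vS vs]; rewrite vS /= inE dE pD //.
  rewrite (_ : v \in I = false); first by move: vs; rewrite inE.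
  apply: contraTF vS; rewrite inE => /andP[cv hv]; apply/negP=> vS.
  by have := hS _ vS cv; rewrite /nbetween; move: hv; clear; lia.
case/hasP: pS => z zp zS; exists z; last by rewrite in_setI negb_and (hps _ zp) orbT.
by rewrite in_setI zS inE dE zp.
Qed.

Hypothesis l0 : 0 < l.

Definition ear x y p :=
  [/\ path e x (rcons p y), uniq (x :: rcons p y) & {in p, forall z, z \notin supp D}].

Definition local x y := [/\ Fconn x y, dist x y <= l &
  exists v, [/\ v \in S, Fconn x v & between x y v]].

Lemma segment_Sconn x y : Fconn x y -> N x <= N y ->
  (forall v, v \in S -> Fconn x v -> ~~ between x y v) -> Sconn x y.
Proof.
move En : (N y - N x) => n; elim: n x En => [|n IH] x En cxy lxy hS.
  have -> : x = y by apply: numN.2 => //; move: En lxy; clear; lia.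
  exact: connect0.
have lt : N x < N y by move: En; clear; lia.
have [z xz ez] := connect_step numN sF cxy lt.
have czx : Fconn z x by rewrite cF connect1.
have cxz : Fconn x z by rewrite connect1.
apply: (@connect_trans _ _ z).
  apply: connect1; rewrite /drel inE (subsetP Fsub) //= !inE.
  apply/andP; split; apply/negP=> h.
    by have := hS _ h (connect0 _ _); rewrite /nbetween leqnn ltnW.
  by have := hS _ h cxz; rewrite /nbetween ez leqnSn lt.
apply: IH; [by move: En ez; clear; lia | exact: connect_trans cxy | by rewrite ez |].
move=> v vS cv; have := hS _ vS (connect_trans cxz cv); apply: contra.
by rewrite /nbetween; move: ez lt; clear; lia.
Qed.

Lemma between_sym x y v : between x y v = between y x v.
Proof. by rewrite /nbetween orbC. Qed.

Lemma dist_sym x y : dist x y = dist y x.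
Proof. by rewrite /ndist addnC. Qed.

Lemma local_inner x y : x \notin core -> y \notin core -> local x y -> ~ outer x /\ ~ outer y.
Proof.
move=> xc yc [cxy dxy [v [vS cv bv]]]; split=> o.
  exact: (outer_no_near_S xc o cxy dxy vS cv bv).
apply: (outer_no_near_S yc o (y := x) (v := v)) => //; first by rewrite cF.
- by rewrite dist_sym.
- by apply: connect_trans cv; rewrite cF.
- by rewrite between_sym.
Qed.

(** For an ear that is not an edge of [D], [ear_blocked] gives a path of [D] from [y] back to [x].
    If it and the ear miss [S], the second alternative holds. Otherwise it is short and stays in [F]
    by [far_exit]; then either the segment between [x] and [y] meets [S], or [no_reroute] keeps the
    ear off [S]. *)
Lemma ear_dichotomy x y p : x \notin core -> y \notin core -> x \in supp D -> y \in supp D ->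
  ear x y p ->
  local x y \/ {in x :: rcons p y, forall z, z \notin S} /\ Sconn x y.
Proof.
move=> xc yc xs ys [hp up hps].
have xU := core_U xc; have yU := core_U yc.
have nxy : x != y by move: up; rewrite /= mem_rcons inE negb_or -andbA => /and3P[].
have deg2 z : z \notin U -> z \in supp D -> deg D z = 2.
  move=> zU; rewrite inE; have := notU_deg zU; have /andP[_] := valid_deg vD z; clear; lia.
have [hD|hD] : (p = [::] /\ (x, y) \in D) \/ (p != [::] \/ (x, y) \notin D).
  have [->|pn] := eqVneq p [::]; last by right; left.
  by have [xy|xy] := boolP ((x, y) \in D); [left | right; right].
- case: hD => -> xy; have xyF : (x, y) \in F by rewrite FE xy xU.
  have cxy : Fconn x y by apply: connect1.
  (* Adjacent vertices of [F] have labels differing by one, and [0 < l]. *)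
  have dxy : dist x y <= l.
    by rewrite /ndist; move: (numN.1 _ _ xyF) l0; clear; lia.
  have [xS|xS] := boolP (x \in S).
    by left; split=> //; exists x; rewrite connect0 /nbetween leqnn /=; split=> //; clear; lia.
  have [yS|yS] := boolP (y \in S).
    by left; split=> //; exists y; rewrite cxy /nbetween leqnn /=; split=> //; clear; lia.
  right; split; first by move=> z; rewrite !inE => /orP[]/eqP->.
  by apply: connect1; rewrite /drel !inE xy xS.
have [r [hr er hlS]] := ear_blocked se ie maxD (deg2 _ xU xs) (deg2 _ yU ys) hp up hps hD.
have xr : x \in y :: r by rewrite -er mem_last.
have [hS|] := boolP (has [in S] (p ++ y :: r)); last first.
  move/hasPn=> hS; right; split.
    move=> z; rewrite inE mem_rcons inE => zz; apply: hS; rewrite mem_cat.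
    by case/or3P: zz => [/eqP->|/eqP->|->//]; rewrite ?xr ?mem_head orbT.
  rewrite /Sconn Sconn_sym; apply/connectP; exists r => //.
  by apply: path_induced => // z zr; rewrite inE; apply: hS; rewrite mem_cat zr orbT.
case: hlS => [lr|]; last by rewrite hS.
have hU : ~~ has [in U] r.
  by apply/negP=> /(far_exit yc hr); move: lr; clear; lia.
have hrF := no_exit hr yU hU.
have cyx : Fconn y x by apply/connectP; exists r.
have cxy : Fconn x y by rewrite cF.
have dxy : dist x y <= l.
  by have := dist_path numN hrF; rewrite er dist_sym; move: lr; clear; lia.
have [|none] := EM (exists v, [/\ v \in S, Fconn x v & between x y v]); first by left.
have hb v : v \in S -> Fconn x v -> ~~ between x y v.
  by move=> vS cv; apply/negP=> bv; apply: none; exists v.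
have hb' v : v \in S -> Fconn y v -> ~~ between y x v.
  by move=> vS cv; rewrite between_sym; apply: hb => //; apply: connect_trans cv.
have nN : N x <> N y by move/(numN.2 _ _ cxy) => exy; rewrite exy eqxx in nxy.
have xS : x \notin S.
  by apply/negP=> h; have := hb _ h (connect0 _ _); rewrite /nbetween; clear; lia.
have yS : y \notin S.
  by apply/negP=> h; have := hb _ h cxy; rewrite /nbetween; clear; lia.
suff [pS cS] : ~~ has [in S] p /\ Sconn x y.
  right; split=> // z; rewrite inE mem_rcons inE => /or3P[/eqP->//|/eqP->//|zp].
  by apply: contra pS => zS; apply/hasP; exists z.
have [lt|lt] : N x < N y \/ N y < N x by move: nN; clear; lia.
  split; first exact: (no_reroute xc yc cxy lt hb hp up hps).
  by apply: segment_Sconn hb => //; apply: ltnW.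
split; last by rewrite /Sconn Sconn_sym; apply: segment_Sconn hb' => //; apply: ltnW.
rewrite -has_rev; apply: (no_reroute yc xc cyx lt hb').
- have := rev_path_sym x (rcons p y) se; rewrite hp last_rcons belast_rcons rev_cons.
  by move=> ->.
- by rewrite -rev_cons -rev_rcons rev_uniq rcons_cons.
- by move=> z; rewrite mem_rev => /hps.
Qed.

(* [Phi] is propagated along the hops of a walk, i.e. its segments between consecutive
   vertices of [H]. *)
Lemma hop_walk (H S' : {set T}) (Phi : T -> Prop) (A : pred T) :
  (forall a b q, A a -> A b -> a \in H -> b \in H ->
     path e a (rcons q b) -> uniq (a :: rcons q b) -> {in q, forall z, z \notin H} ->
     Phi a -> Phi b /\ {in q, forall z, z \notin S'}) ->
  forall x p, path e x p -> uniq (x :: p) -> {in x :: p, forall z, A z} ->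
    x \in H -> last x p \in H -> Phi x ->
    forall v, v \in x :: p -> (v \in H -> Phi v) /\ (v \notin H -> v \notin S').
Proof.
move=> hop x p; have [n] := ubnP (size p); elim: n x p => // n IH x p; rewrite ltnS => hn.
case: p hn => [|a p] hn hp up hA xH lH px v.
  by rewrite inE => /eqP->; rewrite xH; split.
have hH : has [in H] (a :: p).
  by apply/hasP; exists (last x (a :: p)); [rewrite /= mem_last | ].
move: hn hp up hA lH; case/split_find: hH => b q p2 bH /hasPn qH.
rewrite size_cat size_rcons cat_path last_cat last_rcons => hn /andP[h1 h2] up hA lH.
have up1 : uniq (x :: rcons q b) by move: up; rewrite -cat_cons cat_uniq => /and3P[].
have up2 : uniq (b :: p2).
  by move: up; rewrite cat_rcons -cat_cons cat_uniq => /and3P[].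
have [pb qS] : Phi b /\ {in q, forall z, z \notin S'}.
  apply: (hop x b q) => //; apply: hA; first by rewrite mem_head.
  by rewrite inE mem_cat mem_rcons mem_head !orbT.
have hA2 : {in b :: p2, forall z, A z}.
  move=> z zp; apply: hA; rewrite cat_rcons inE mem_cat zp !orbT //.
have {}IH := IH b p2 _ h2 up2 hA2 bH lH pb.
rewrite cat_rcons inE mem_cat => /or3P[/eqP->|vq|]; first by rewrite xH; split.
  by have := qH _ vq => /= /negbTE vH; rewrite vH; split=> // _; apply: qS.
by apply: IH; move: hn; clear; lia.
Qed.

(** The cycle splits into two arcs between [x] and [z], traversed one after the other. The second
    vertex [z] of [H] is there because [hop_walk] concerns simple paths with both ends in [H]. *)
Lemma hop_cycle (H S' : {set T}) (Phi : T -> Prop) c x z :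
  (forall a b q, a \in c -> b \in c -> a \in H -> b \in H ->
     path e a (rcons q b) -> uniq (a :: rcons q b) -> {in q, forall z, z \notin H} ->
     Phi a -> Phi b /\ {in q, forall z, z \notin S'}) ->
  cycle e c -> uniq c -> x \in c -> z \in c -> x \in H -> z \in H -> x != z -> Phi x ->
  forall v, v \in c -> (v \in H -> Phi v) /\ (v \notin H -> v \notin S').
Proof.
move=> hop cc uc xc zc xH zH nxz px v vc.
have [i p1 p2 _ _ er] := rot_to_arc uc xc zc nxz.
have := cc; rewrite -(rot_cycle i) er /= rcons_cat /= cat_path /= => /and3P[h1 h2 h3].
have ur : uniq (x :: p1 ++ z :: p2) by rewrite -er rot_uniq.
have rc y : y \in x :: p1 ++ z :: p2 -> y \in c by rewrite -er mem_rot.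
have hp1 : path e x (rcons p1 z) by rewrite rcons_path h1.
have u1 : uniq (x :: rcons p1 z).
  by move: ur; rewrite -cat_rcons -cat_cons cat_uniq => /and3P[].
have u2 : uniq (z :: rcons p2 x).
  have : uniq (rot (size (x :: p1)) ((x :: p1) ++ z :: p2)) by rewrite rot_uniq cat_cons.
  by rewrite rot_size_cat -cat_rcons rcons_cons cat_uniq => /and3P[].
have s1 : {in x :: rcons p1 z, forall y, y \in c}.
  move=> y yy; apply: rc; rewrite -cat_rcons -cat_cons mem_cat yy //.
have s2 : {in z :: rcons p2 x, forall y, y \in c}.
  move=> y; rewrite inE mem_rcons inE => yy; apply: rc.
  by rewrite inE mem_cat inE; case/or3P: yy => [->|->|->]; rewrite ?orbT.
have w1 := @hop_walk H S' Phi (mem c) hop x (rcons p1 z) hp1 u1 s1 xH.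
rewrite last_rcons in w1; have {}w1 := w1 zH px.
have pz : Phi z by apply: (w1 z _).1 => //; rewrite inE mem_rcons mem_head orbT.
have w2 := @hop_walk H S' Phi (mem c) hop z (rcons p2 x) h3 u2 s2 zH.
rewrite last_rcons in w2; have {}w2 := w2 xH pz.
move: vc; rewrite -(mem_rot i) er inE mem_cat inE => /or4P[h|h|h|h].
- by apply: w1; rewrite inE h.
- by apply: w1; rewrite inE mem_rcons inE h !orbT.
- by apply: w2; rewrite inE h.
- by apply: w2; rewrite inE mem_rcons inE h !orbT.
Qed.

Lemma path_to_set (H : {set T}) c w : cycle e c -> uniq c -> w \in c -> w \notin H -> has [in H] c ->
  exists q x, [/\ x \in c, x \in H, path e w (rcons q x), uniq (w :: rcons q x) &
    {in q, forall z, z \in c /\ z \notin H}].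
Proof.
move=> cc uc wc wH hH; case/rot_to: wc => i q er.
have hq : has [in H] q.
  case/hasP: hH => z zc zH; apply/hasP; exists z => //.
  move: zc; rewrite -(mem_rot i) er inE => /predU1P[ez|//].
  by move: zH; rewrite /= ez (negbTE wH).
have := cc; have := uc; rewrite -(rot_uniq i) -(rot_cycle i) er.
have qc z : z \in q -> z \in c by move=> zq; rewrite -(mem_rot i) er inE zq orbT.
move: qc; case/split_find: hq => x q1 q2 xH /hasPn q1H qc uq.
rewrite /cycle rcons_cat cat_path => /andP[h1 _].
exists q1, x; split=> //.
- by apply: qc; rewrite mem_cat mem_rcons mem_head.
- by move: uq; rewrite -cat_cons cat_uniq => /and3P[].
- move=> z zq; split; last by apply: q1H.
  by apply: qc; rewrite mem_cat mem_rcons inE zq orbT.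
Qed.

Lemma rev_rcons_path x p y : path e x (rcons p y) -> path e y (rcons (rev p) x).
Proof.
by have := rev_path_sym x (rcons p y) se; rewrite last_rcons belast_rcons rev_cons => ->.
Qed.

(** From the common vertex [w], walk along each cycle to its first vertex in [supp D]. If these two
    differ, the walk between them through [w] shortens to an ear. *)
Lemma join_ear c c' w : cycle e c -> uniq c -> has [in supp D] c ->
  cycle e c' -> uniq c' -> has [in supp D] c' -> w \in c -> w \in c' ->
  exists x y, [/\ x \in c, y \in c', x \in supp D, y \in supp D & x = y \/ exists p, ear x y p].
Proof.
move=> cc uc hc cc' uc' hc' wc wc'.
have [ws|ws] := boolP (w \in supp D); first by exists w, w; split=> //; left.
have [q [x [xc xs hq _ qs]]] := path_to_set cc uc wc ws hc.
have [q' [y [yc ys hq' _ qs']]] := path_to_set cc' uc' wc' ws hc'.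
exists x, y; split=> //; have [->|nxy] := eqVneq x y; [by left | right].
have hp : path e x (rcons (rev q) w ++ rcons q' y).
  by rewrite cat_path last_rcons hq' andbT; apply: rev_rcons_path.
have el : last x (rcons (rev q) w ++ rcons q' y) = y by rewrite last_cat !last_rcons.
have {hp el} [p [hp up el sp]] : exists p, [/\ path e x p, uniq (x :: p), last x p = y &
    {subset p <= rcons (rev q) w ++ rcons q' y}].
  by move: el; case/shortenP: hp => p hp up sp el; exists p.
case/lastP: p hp up el sp => [|p b] hp up el sp; first by rewrite -el eqxx in nxy.
rewrite last_rcons in el; subst b; exists p; split=> // z zp.
have nzy : z != y.
  by apply: contraTneq zp => ->; move: up; rewrite /= rcons_uniq => /and3P[].
have : z \in rcons (rev q) w ++ rcons q' y by apply: sp; rewrite mem_rcons inE zp orbT.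
rewrite mem_cat !mem_rcons !in_cons mem_rev (negbTE nzy) /=.
by rewrite -orbA => /or3P[/eqP->|/qs[]|/qs'[]].
Qed.

(** * Long cycles avoiding the core *)

Definition long_cycle c := [/\ 2 < size c, cycle e c, uniq c & good S l c].
Definition pendant c := exists2 z, z \in c & z \in supp D /\ forall v, v \in c -> v \in supp D -> v = z.

Lemma long_cycle_supp c : long_cycle c -> has [in supp D] c.
Proof. by case=> h1 h2 h3 h4; apply: (good_cycle_meets se ie maxD). Qed.

Lemma avoid_core c z : [disjoint c & core] -> z \in c -> z \notin core.
Proof. by move=> /disjointFr h /h ->. Qed.

Lemma not_pendant c x : x \in c -> x \in supp D -> ~ pendant c ->
  exists z, [/\ z \in c, z \in supp D & x != z].
Proof.
move=> xc xs hn; apply: contrapT => none; apply: hn; exists x => //; split=> // v vc vs.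
by apply/eqP; apply: contraT => nvx; case: none; exists v; rewrite eq_sym.
Qed.

Lemma cycle_arc_S c z w : 2 < size c -> cycle e c -> uniq c -> z \in c -> w \in c -> z != w ->
  has [in S] c -> exists p, [/\ path e z (rcons p w), uniq (z :: rcons p w),
    {subset z :: rcons p w <= c} & has [in S] (z :: rcons p w)].
Proof.
move=> sc cc uc zc wc nzw /hasP[s sc' sS].
have [i p1 p2 _ _ er] := rot_to_arc uc zc wc nzw.
have := cc; rewrite -(rot_cycle i) er /= rcons_cat /= cat_path /= => /and3P[h1 h2 h3].
have ur : uniq (z :: p1 ++ w :: p2) by rewrite -er rot_uniq.
have rc y : y \in c = (y \in z :: p1 ++ w :: p2) by rewrite -er mem_rot.
have [sp|sp] := boolP (s \in z :: rcons p1 w).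
  have hS : has [in S] (z :: rcons p1 w) by apply/hasP; exists s.
  exists p1; split=> //.
  - by rewrite rcons_path h1.
  - by move: ur; rewrite -cat_rcons -cat_cons cat_uniq => /and3P[].
  - by move=> y yy; rewrite rc -cat_rcons -cat_cons mem_cat yy.
have hS : has [in S] (z :: rcons (rev p2) w).
  apply/hasP; exists s => //; move: sc' sp; rewrite rc -cat_rcons -cat_cons mem_cat => /orP[->//|h] _.
  by rewrite inE mem_rcons inE mem_rev h !orbT.
exists (rev p2); split=> //.
- exact: rev_rcons_path.
- have : uniq (rot (size (z :: p1)) ((z :: p1) ++ w :: p2)) by rewrite rot_uniq cat_cons.
  rewrite rot_size_cat -cat_rcons rcons_cons cat_uniq => /and3P[h _ _].
  by rewrite -[_ && _]/(uniq (z :: rcons (rev p2) w)) -rev_cons -rev_rcons rev_uniq.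
- move=> y; rewrite rc inE mem_rcons inE mem_rev inE mem_cat inE.
  by case/or3P=> ->; rewrite ?orbT.
Qed.

(** If [c'] meets [c], follow [c'] from a vertex [y] of [supp D] to [c], and then an arc of [c]
    meeting [S] to [z]. This ear meets [S], so it is local by [ear_dichotomy], and [y] lies in the
    deleted ball. *)
Lemma pendant_step c z : long_cycle c -> [disjoint c & core] -> z \in c -> z \in supp D ->
  (forall v, v \in c -> v \in supp D -> v = z) ->
  forall c', long_cycle c' -> [disjoint c' & core] -> [disjoint c' & ball F N l z] ->
  [disjoint c & c'].
Proof.
move=> gc dc zc zs hz c' gc' dc' dY; apply: contraT; case/pred0Pn=> w /andP[/= wc wc'].
have zc' : z \notin c'.
  apply/negP=> /(disjointFr dY); rewrite ballE connect0 /ndist; clear; lia.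
have ws : w \notin supp D.
  by apply: contra zc' => ws; rewrite -(hz w).
have := long_cycle_supp gc'; have [sc' cc' uc' _] := gc'.
case/(path_to_set cc' uc' wc' ws) => q [y [yc' ys hq uq qs]].
have nzy : z != y by apply: contraNneq zc' => ->.
have yc : y \notin c by apply: contra nzy => yc; rewrite (hz y yc ys).
have hq' := rev_rcons_path hq.
have hc : has [in c] (rcons (rev q) w) by apply/hasP; exists w; rewrite ?mem_rcons ?mem_head.
have uq' : uniq (y :: rcons (rev q) w).
  by rewrite -rev_cons -rev_rcons rev_uniq.
have qs' u : u \in rcons (rev q) w -> u \notin supp D.
  by rewrite mem_rcons inE mem_rev => /predU1P[->//|/qs[]].
(* Stopping at the first vertex [w'] of [c] makes the two parts of the ear meet only there. *)
move: hq' uq' qs'; case/split_find: hc => w' q3 q4 w'c /hasPn q3c.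
rewrite cat_path -cat_cons cat_uniq => /andP[hq3 _] /and3P[uq3 _ _] qs'.
have w's : w' \notin supp D by apply: qs'; rewrite mem_cat mem_rcons mem_head.
have nzw : z != w' by apply: contraNneq w's => <-.
have [sc cc uc /andP[_ hS]] := gc.
have [p [hp up sp pS]] := cycle_arc_S sc cc uc zc w'c nzw hS.
have pz : z \notin rcons p w' by move: up => /= /andP[].
have hear : ear z y (rcons p w' ++ rev q3).
  split.
  - rewrite rcons_cat cat_path hp last_rcons; exact: rev_rcons_path.
  - rewrite rcons_cat -cat_cons cat_uniq up andTb; apply/andP; split.
      apply/hasPn=> u; rewrite mem_rcons inE mem_rev => /predU1P[->|/q3c uc3].
        by apply: contra yc => /sp.
      by apply: contra uc3 => /sp.
    move: uq3; rewrite cons_uniq mem_rcons inE negb_or rcons_uniq => /andP[/andP[_ yq] /andP[_ uq']].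
    by rewrite rcons_uniq mem_rev yq rev_uniq.
  move=> u; rewrite mem_cat mem_rev => /orP[up'|uq3'].
    by apply: contra pz => us; rewrite -(hz u _ us) // sp // inE up' orbT.
  by apply: qs'; rewrite mem_cat mem_rcons inE uq3' orbT.
have zcore := avoid_core dc zc; have ycore := avoid_core dc' yc'.
case: (ear_dichotomy zcore ycore zs ys hear) => [[cy dy _]|[hF _]].
  by have := disjointFr dY yc'; rewrite ballE cy dy.
case/hasP: pS => u up' uS; have := hF u; rewrite uS => h; apply: h.
move: up'; rewrite rcons_cat -cat_cons mem_cat => -> //.
Qed.

Lemma outer_notS x : outer x -> x \notin S.
Proof. by case=> b _ [cb hb]; apply/negP=> xS; have := hb _ xS cb; rewrite ltnn. Qed.

(** If [x] were outer, so would be every vertex of [c] in [supp D]: local ears have no outer ends,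
    and all other ears miss [S] and preserve [outer]. Then [c] would miss [S] altogether. *)
Lemma cycle_inner c x : long_cycle c -> [disjoint c & core] -> ~ pendant c ->
  x \in c -> x \in supp D -> ~ outer x.
Proof.
move=> gc dc np xc xs ox; have [z [zc zs nxz]] := not_pendant xc xs np.
have [_ cc uc /andP[_ /hasP[s sc sS]]] := gc.
have [|h1 h2] := @hop_cycle (supp D) S outer c x z _ cc uc xc zc xs zs nxz ox s sc.
  move=> a b q ac bc as_ bs hp up hq oa.
  have acore := avoid_core dc ac; have bcore := avoid_core dc bc.
  case: (ear_dichotomy acore bcore as_ bs (And3 hp up hq)) => [lab|[hS sab]].
    by case: (local_inner acore bcore lab).
  split; last by move=> u uq; apply: hS; rewrite inE mem_rcons inE uq !orbT.
  exact: (Sconn_outer (core_U acore) (core_U bcore) (outer_notS oa) sab oa).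
have [ss|ss] := boolP (s \in supp D); last by have := h2 ss; rewrite sS.
by have := outer_notS (h1 ss); rewrite sS.
Qed.

Lemma inner_ear_conn x y p : x \notin core -> y \notin core -> x \in supp D -> y \in supp D ->
  ~ outer x -> ear x y p ->
  Fconn x y /\ (dist x y <= l \/ forall v, v \in S -> Fconn x v -> ~~ between x y v).
Proof.
move=> xc yc xs ys ox h; case: (ear_dichotomy xc yc xs ys h) => [[h1 h2 _]|[hS sab]].
  by split=> //; left.
have xS : x \notin S by apply: hS; rewrite mem_head.
by have [h1 h2] := Sconn_inner (core_U xc) xS sab ox; split=> //; right.
Qed.

(** By [cycle_inner] all ears of [c] start at inner vertices, so each has both ends on one path of
    [F]. *)
Lemma cycle_Fconn c x y : long_cycle c -> [disjoint c & core] -> ~ pendant c ->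
  x \in c -> x \in supp D -> y \in c -> y \in supp D -> Fconn x y.
Proof.
move=> gc dc np xc xs yc ys; have [z [zc zs nxz]] := not_pendant xc xs np.
have [_ cc uc _] := gc.
have [|h1 h2] := @hop_cycle (supp D) set0 (fun v => Fconn x v) c x z _ cc uc xc zc xs zs nxz (connect0 _ _) y yc.
  move=> a b q ac bc as_ bs hp up hq ca.
  have acore := avoid_core dc ac; have bcore := avoid_core dc bc.
  have oa := cycle_inner gc dc np ac as_.
  have [cab _] := inner_ear_conn acore bcore as_ bs oa (And3 hp up hq).
  by split; [apply: connect_trans cab | move=> u _; rewrite inE].
exact: h1.
Qed.

(** An ear from an inner vertex that passes over [s] has ends at distance at most [l], which puts
    [y] into the ball around [s]. The case [x = y] serves two cycles sharing a vertex of
    [supp D]. *)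
Lemma ear_no_jump x y p s : x \notin core -> y \notin core -> x \in supp D -> y \in supp D ->
  ~ outer x -> ear x y p \/ x = y -> s \in S -> Fconn x s -> y \notin ball F N l s ->
  (N x <= N s -> N y < N s) /\ (N s <= N x -> N s < N y).
Proof.
move=> xc yc xs ys ox hxy sS cxs; rewrite ballE => yb.
have [cxy h] : Fconn x y /\ (dist x y <= l \/ forall v, v \in S -> Fconn x v -> ~~ between x y v).
  case: hxy => [/inner_ear_conn|<-]; first exact.
  by rewrite connect0; split=> //; left; rewrite /ndist; clear; lia.
have csy : Fconn s y by apply: connect_trans cxy; rewrite cF.
move: yb; rewrite csy /= => yb.
by case: h => [|/(_ s sS cxs)]; move: yb; rewrite /ndist /nbetween; clear; lia.
Qed.

(** Minimising this compares labels across different paths of [F], but the outcome is only used for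
    two cycles on the same path. *)
Definition top c := \max_(v in [set v in c | v \in supp D]) N v.

Lemma top_ge c v : v \in c -> v \in supp D -> N v <= top c.
Proof. by move=> vc vs; apply: leq_bigmax_cond; rewrite inE vc. Qed.

Lemma top_attained c : has [in supp D] c -> exists v, [/\ v \in c, v \in supp D & N v = top c].
Proof.
case/hasP=> v vc vs.
have h : 0 < #|[set v in c | v \in supp D]| by apply/card_gt0P; exists v; rewrite inE vc.
have [w] := eq_bigmax_cond N h; rewrite inE => /andP[wc ws] ew.
by exists w; split=> //; rewrite -ew.
Qed.

(** The function [f] is a parameter so that one statement finds the nearest vertex of [S] on either
    side of a given vertex; with no candidate, [Y] is empty. *)
Lemma nearest_ball (f : T -> nat) (P : T -> Prop) :
  exists2 Y : {set T}, #|Y| <= 2 * l + 1 &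
    forall v, P v -> exists s, [/\ P s, f s <= f v & ball F N l s \subset Y].
Proof.
have [[v0 Pv0]|none] := EM (exists v, P v); last first.
  by exists set0; rewrite ?cards0 // => v Pv; case: none; exists v.
have h : `[<P v0>] by apply/asboolP.
case: (arg_minnP (P := fun v => `[<P v>]) f h) => s /asboolP Ps hs.
exists (ball F N l s) => [|v Pv].
  by have := card_ball numN sF l s; clear; move: #|_| => m; lia.
by exists s; split=> //; apply: hs; apply/asboolP.
Qed.

(** If no remaining cycle is pendant, take [c] with lowest top [t], and for [Y] the balls around the
    nearest vertices of [S] above and below [t]. A cycle [c'] meeting [c] but avoiding [Y] would be
    trapped strictly between these two vertices, and would then miss [S]. *)
Lemma greedy_step (Z : {set T}) :
  (exists2 c, long_cycle c /\ [disjoint c & core] & [disjoint c & Z]) ->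
  exists c (Y : {set T}), [/\ long_cycle c /\ [disjoint c & core], [disjoint c & Z],
    #|Y| <= 4 * l + 2 &
    forall c', long_cycle c' /\ [disjoint c' & core] -> [disjoint c' & Z] ->
      [disjoint c' & Y] -> [disjoint c & c']].
Proof.
move=> [c0 hc0 dc0].
have [[c [[gc dc] dZ [z zc [zs hz]]]]|noP] :=
    EM (exists c, [/\ long_cycle c /\ [disjoint c & core], [disjoint c & Z] & pendant c]).
  exists c, (ball F N l z); split=> //.
    by have := card_ball numN sF l z; clear; move: #|_| => m; lia.
  by move=> c' [gc' dc'] _; apply: (pendant_step gc dc zc zs hz).
have {noP} noP c : long_cycle c -> [disjoint c & core] -> [disjoint c & Z] -> ~ pendant c.
  by move=> h1 h2 h3 h4; apply: noP; exists c.
have [c [[gc dc] dZ] minc] := @ex_minimal _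
  (fun c => (long_cycle c /\ [disjoint c & core]) /\ [disjoint c & Z]) top c0 (conj hc0 dc0).
have np := noP _ gc dc dZ.
have [t [tc ts et]] := top_attained (long_cycle_supp gc).
have [Y1 sY1 hY1] := nearest_ball N (fun v => [/\ v \in S, Fconn t v & N t <= N v]).
have [Y2 sY2 hY2] := nearest_ball (fun v => N t - N v) (fun v => [/\ v \in S, Fconn t v & N v <= N t]).
exists c, (Y1 :|: Y2); split=> //.
  apply: leq_trans (leq_card_setU _ _) _; move: sY1 sY2; clear.
  by move: #|_| #|_| => a b; lia.
move=> c' [gc' dc'] dZ' dY; apply: contraT; case/pred0Pn=> w /andP[/= wc wc'].
have np' := noP _ gc' dc' dZ'.
have notY (A : {set T}) v : v \in c' -> A \subset Y1 :|: Y2 -> v \notin A.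
  by move=> vc' /subsetP sA; apply/negP=> /sA h; have := disjointFr dY vc'; rewrite h.
have [_ cc uc _] := gc; have [_ cc' uc' /andP[_ hS']] := gc'.
have [x0 [y0 [xc yc xs ys hxy]]] :=
  join_ear cc uc (long_cycle_supp gc) cc' uc' (long_cycle_supp gc') wc wc'.
have hxy' : (exists p, ear x0 y0 p) \/ x0 = y0 by case: hxy; [right|left].
have x0core := avoid_core dc xc; have y0core := avoid_core dc' yc.
have ox0 := cycle_inner gc dc np xc xs.
have ctx : Fconn t x0 := cycle_Fconn gc dc np tc ts xc xs.
have cxy : Fconn x0 y0.
  case: hxy => [<-|[p hp]]; first exact: connect0.
  by case: (inner_ear_conn x0core y0core xs ys ox0 hp).
have ct v : v \in c' -> v \in supp D -> Fconn t v.
  move=> vc vs; apply: connect_trans (connect_trans ctx cxy) _.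
  exact: cycle_Fconn gc' dc' np' yc ys vc vs.
have [z0 [zc' zs nyz]] := not_pendant yc ys np'.
have jump a b q s : a \in c' -> b \in c' -> a \in supp D -> b \in supp D -> ear a b q ->
    s \in S -> Fconn t s -> ball F N l s \subset Y1 :|: Y2 ->
    (N a <= N s -> N b < N s) /\ (N s <= N a -> N s < N b).
  move=> ac bc as_ bs hq sS cs sb.
  have oa := cycle_inner gc' dc' np' ac as_.
  have cas : Fconn a s by apply: connect_trans cs; rewrite cF; apply: ct.
  exact: (ear_no_jump (avoid_core dc' ac) (avoid_core dc' bc) as_ bs oa (or_introl hq) sS cas (notY _ _ bc sb)).
have above v y : v \in S -> Fconn t v -> N t <= N v -> y \in c' -> y \in supp D -> N y < N v.
  move=> vS cv lv yc' ys'; have [s [[sS cs ls] sv /subset_trans sb]] := hY1 v (And3 vS cv lv).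
  have {}sb := sb _ (subsetUl Y1 Y2); apply: leq_trans sv.
  (* The vertex [x0] of [c] lies at or below the top [t], hence not above [s], and the connection to
     [y0] cannot jump over [s]. *)
  have start : N y0 < N s.
    have cxs : Fconn x0 s by apply: connect_trans cs; rewrite cF.
    have hx : N x0 <= N s by apply: leq_trans ls; rewrite et; apply: top_ge.
    case: hxy' => [[p hp]|exy].
      by apply: (ear_no_jump x0core y0core xs ys ox0 (or_introl hp) sS cxs (notY _ _ yc sb)).1.
    by apply: (@ear_no_jump x0 y0 [::] s x0core y0core xs ys ox0 (or_intror exy) sS cxs (notY _ _ yc sb)).1.
  have [|h _] := @hop_cycle (supp D) set0 (fun u => N u < N s) c' y0 z0 _ cc' uc' yc zc' ys zs nyz start y yc'.
    move=> a b q ac bc as_ bs hp up hq la; split; last by move=> u _; rewrite inE.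
    exact: (jump _ _ _ _ ac bc as_ bs (And3 hp up hq) sS cs sb).1 (ltnW la).
  exact: h.
have below v y : v \in S -> Fconn t v -> N v <= N t -> y \in c' -> y \in supp D -> N v < N y.
  move=> vS cv lv yc' ys'; have [s [[sS cs ls] sv /subset_trans sb]] := hY2 v (And3 vS cv lv).
  have {}sb := sb _ (subsetUr Y1 Y2).
  apply: (@leq_ltn_trans (N s)); first by move: sv lv ls; clear; lia.
  have [t' [tc' ts' et']] := top_attained (long_cycle_supp gc').
  (* Here the choice of [c] matters: the top [t'] of [c'] is not below [t], and so not below [s]. *)
  have start : N s < N t'.
    have le1 : N s <= N t'.
      by apply: leq_trans ls _; rewrite et et'; apply: minc.
    rewrite ltn_neqAle le1 andbT; apply: contraNneq (notY _ _ tc' sb) => es.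
    have <- : s = t'.
      by apply: numN.2 es; apply: connect_trans (ct _ tc' ts'); rewrite cF.
    by rewrite ballE connect0 /ndist; clear; lia.
  have [z1 [zc1 zs1 nyz1]] := not_pendant tc' ts' np'.
  have [|h _] := @hop_cycle (supp D) set0 (fun u => N s < N u) c' t' z1 _ cc' uc' tc' zc1 ts' zs1 nyz1 start y yc'.
    move=> a b q ac bc as_ bs hp up hq la; split; last by move=> u _; rewrite inE.
    exact: (jump _ _ _ _ ac bc as_ bs (And3 hp up hq) sS cs sb).2 (ltnW la).
  exact: h.
have suppS y : y \in c' -> y \in supp D -> y \notin S.
  move=> yc' ys'; apply/negP=> yS; have cy := ct _ yc' ys'.
  have [lt|lt] := leqP (N t) (N y); first by have := above _ _ yS cy lt yc' ys'; rewrite ltnn.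
  by have := below _ _ yS cy (ltnW lt) yc' ys'; rewrite ltnn.
case/hasP: hS' => s sc' sS.
have [|_ h] := @hop_cycle (supp D) S (fun=> True) c' y0 z0 _ cc' uc' yc zc' ys zs nyz I s sc'.
  move=> a b q ac bc as_ bs hp up hq _; split=> // u uq.
  case: (ear_dichotomy (avoid_core dc' ac) (avoid_core dc' bc) as_ bs (And3 hp up hq)); last first.
    by case=> hF _; apply: hF; rewrite inE mem_rcons inE uq !orbT.
  (* A local ear of [c'] has a vertex [v] of [S] between its ends, whereas both ends lie strictly on
     one side of [v] by [above] or [below]. *)
  case=> _ _ [v [vS cv bv]]; have ctv := connect_trans (ct _ ac as_) cv; exfalso.
  have [lt|lt] := leqP (N t) (N v).
    have := above _ _ vS ctv lt ac as_; have := above _ _ vS ctv lt bc bs.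
    by move: bv; rewrite /nbetween; clear; lia.
  have := below _ _ vS ctv (ltnW lt) ac as_; have := below _ _ vS ctv (ltnW lt) bc bs.
  by move: bv; rewrite /nbetween; clear; lia.
have [ss|ss] := boolP (s \in supp D); first by have := suppS _ sc' ss; rewrite sS.
by have := h ss; rewrite sS.
Qed.

Lemma pack_avoiding_core k :
  (exists C : 'I_k -> seq T, (forall i, long_cycle (C i)) /\
     (forall i j, i != j -> [disjoint C i & C j])) \/
  (exists2 X : {set T}, #|X| <= #|U| * (12 * l + 7) + k * (4 * l + 2) &
     forall c, long_cycle c -> ~~ [disjoint c & X]).
Proof.
case: (greedy_packing greedy_step k) => [[C [h1 h2]]|[X sX hX]].
  by left; exists C; split=> // i; case: (h1 i).
right; exists (core :|: X).
  apply: leq_trans (leq_card_setU _ _) _; apply: leq_add; first exact: card_core.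
  by apply: leq_trans sX _; rewrite leq_mul2r leq_pred orbT.
move=> c gc; have [dc|dc] := boolP [disjoint c & core]; last first.
  by apply: contra dc; apply: disjointWr; apply: subsetUl.
by apply: contra (hX c (conj gc dc)); apply: disjointWr; apply: subsetUr.
Qed.

End Frame.

(** * The Erdos-Posa bound *)

(** In maximum degree 2 a cycle contains all neighbours of its vertices, so walking round [c] never
    leaves [c']. *)
Lemma dcycle_absorb (T : finType) (D : {set T * T}) c c' w :
  symmetric (drel D) -> (forall x, deg D x <= 2) -> dcycle D c -> dcycle D c' ->
  w \in c -> w \in c' -> {subset c <= c'}.
Proof.
move=> sD dD hc hc' wc wc' v vc; have [_ cc _] := and3P hc.
case/rot_to: wc => i q er; have := cc; rewrite -(rot_cycle i) er /= => hp.
have {hp} : path (drel D) w q by move: hp; rewrite rcons_path => /andP[].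
move: vc; rewrite -(mem_rot i) er; elim: q w wc' {er} => [|a q IH] w wc'.
  by move=> + _; rewrite inE => /eqP->.
rewrite inE => /predU1P[->//|vq] /= /andP[wa hq].
by apply: IH vq hq; apply: (dcycle_nb sD hc' wc' (dD w) wa).
Qed.

(** If [D] has large excess, [cubic_packing] applies to it. Otherwise [D] has few branch vertices;
    unless [k] disjoint cycles remain after deleting them, at most [k] further vertices destroy all
    cycles of the rest, and [U] consists of both kinds of vertices. *)
Theorem long_cycle_packing (T : finType) (e : rel T) (S : {set T}) l k i :
  symmetric e -> irreflexive e -> 0 < l -> 2 * (k * (2 * i + 3)) + 2 <= 2 ^ i ->
  (exists C : 'I_k -> seq T, (forall j, long_cycle e S l (C j)) /\
     (forall j j', j != j' -> [disjoint C j & C j'])) \/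
  (exists2 X : {set T}, #|X| <= (2 * (k * (2 * i + 3)) + k) * (12 * l + 7) + k * (4 * l + 2) &
     forall c, long_cycle e S l c -> ~~ [disjoint c & X]).
Proof.
move=> se ie l0 hi; have [D maxD] := exists_maximal e S l.
have [vD _ _] := maxD; have sD := valid_sym vD.
have iD := edge_irrefl_darts ie (valid_edge vD).
have d3 x : deg D x <= 3 by case/andP: (valid_deg vD x).
have d1 x : deg D x != 1 by case/andP: (valid_deg vD x).
have longD c : dcycle D c -> long_cycle e S l c.
  move=> hc; have [h1 h2 h3] := and3P hc; split=> //; last exact: (valid_good vD).
  by apply: sub_cycle h2 => a b; apply: (valid_edge vD).
have [hm|hm] := leqP (2 * #|supp D| + 2 * (k * (2 * i + 3))) #|D|.
  have [C [h1 h2]] := cubic_packing sD iD d3 hi hm.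
  by left; exists C; split=> // j; apply/longD/h1.
have hb : #|branch D| <= 2 * (k * (2 * i + 3)).
  move: hm; rewrite (card_darts_cubic d1 d3); clear; move: #|_| #|_| => a b; lia.
pose D0 := induced D (~: branch D).
have sD0 : symmetric (drel D0) by apply: induced_sym.
have d2 (W : {set T}) x : branch D \subset W -> deg (induced D (~: W)) x <= 2.
  move=> sW; have [xW|xW] := boolP (x \in W).
    rewrite /deg (_ : nb _ x = set0) ?cards0 //; apply/setP=> y.
    by rewrite in_nb !inE /= xW andbF.
  apply: leq_trans (deg_mono x (induced_sub D _)) _.
  have : x \notin branch D by apply: contra xW => /(subsetP sW).
  by rewrite inE; have := d3 x; clear; lia.
have step (Z : {set T}) : (exists2 c, dcycle D0 c & [disjoint c & Z]) ->
     exists c (Y : {set T}), [/\ dcycle D0 c, [disjoint c & Z], #|Y| <= 1 &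
       forall c', dcycle D0 c' -> [disjoint c' & Z] -> [disjoint c' & Y] -> [disjoint c & c']].
  case=> c hc dc; have /and3P[sc _ _] := hc.
  have [v vc] : exists v, v \in c by case: c sc {hc dc} => // v c; exists v; rewrite mem_head.
  exists c, [set v]; split; rewrite ?cards1 // => c' hc' _ dv.
  apply: contraT => /pred0Pn[w /andP[/= wc wc']].
  have vc' := dcycle_absorb sD0 (fun x => d2 _ x (subxx _)) hc hc' wc wc' vc.
  by have := disjointFr dv vc'; rewrite inE eqxx.
have [[C [h1 h2]]|[A sA hA]] := greedy_packing step k.
  by left; exists C; split=> // j; apply/longD/(dcycle_mono _ (h1 j))/induced_sub.
pose U := branch D :|: A.
have bU : branch D \subset U by apply: subsetUl.
have [|||c|N numN] := @numbering_exists T (induced D (~: U)).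
- exact: induced_sym.
- by move=> x; apply: contraFF (iD x); apply: (subsetP (induced_sub _ _)).
- by move=> x; apply: d2.
- apply/negP=> hc; have /hA/negP[] : dcycle D0 c.
    by apply: dcycle_mono hc; apply: induced_mono; rewrite setCS; apply: bU.
  apply/pred0P=> w /=; apply/negbTE/negP=> /andP[wc wA].
  have := dcycle_deg (induced_sym _ sD) hc wc; rewrite ltnNge => /negP; apply.
  rewrite /deg (_ : nb _ w = set0) ?cards0 //; apply/setP=> y.
  by rewrite in_nb in_set /= !in_setC in_setU wA orbT /= andbF in_set0.
have cU : #|U| <= 2 * (k * (2 * i + 3)) + k.
  apply: leq_trans (leq_card_setU _ _) _; apply: leq_add => //.
  by apply: leq_trans sA _; rewrite muln1 leq_pred.
case: (pack_avoiding_core se ie maxD bU numN l0 k) => [|[X sX hX]]; [by left | right].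
exists X => //; apply: leq_trans sX _; by rewrite leq_add2r leq_mul2r cU orbT.
Qed.

(** The exponent [6 * L] is logarithmic in [k] when [L] is. Of the factors of [2 ^ (6 * L)], one
    [2 ^ L] dominates [k], another dominates [2 * L], and [16 ^ L] absorbs the constants. *)
Lemma exponent_bound k L : 0 < L -> k <= 2 ^ L -> 2 * (k * (2 * (6 * L) + 3)) + 2 <= 2 ^ (6 * L).
Proof.
move=> L0 kL; have hL : 2 * L <= 2 ^ L.
  case: L L0 {kL} => // L _; rewrite expnS leq_mul2l /=; exact: ltn_expl.
have h16 : 16 <= 16 ^ L by rewrite -{1}(expn1 16) leq_exp2l.
have -> : 2 ^ (6 * L) = 2 ^ L * 2 ^ L * 16 ^ L.
  by rewrite -expnD -[16]/(2 ^ 4) -expnM -expnD; congr (2 ^ _); lia.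
have h1 : k * L <= 2 ^ L * L by rewrite leq_mul2r kL orbT.
have h2 : 2 ^ L * (2 * L) <= 2 ^ L * 2 ^ L by rewrite leq_mul2l hL orbT.
have h3 : 2 ^ L * 2 ^ L * 16 <= 2 ^ L * 2 ^ L * 16 ^ L by rewrite leq_mul2l h16 orbT.
have h4 : k <= k * L by rewrite leq_pmulr.
have h5 : 4 <= 2 ^ L * 2 ^ L by rewrite -expnD -{1}[4]/(2 ^ 2) leq_exp2l //; lia.
move: h1 h2 h3 h4 h5; clear; move: (2 ^ L * 2 ^ L * 16 ^ L) (2 ^ L * 2 ^ L) (2 ^ L) => P Q R; lia.
Qed.

(** * Transfer to simple graphs, vertex deletion and real logarithms *)

Lemma long_S_cycleE (G : sgraph) (S : {set G}) l c :
  long_S_cycle S l c <-> long_cycle (@edge G) S l c.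
Proof.
rewrite /long_S_cycle /S_cycle /is_cycle /long_cycle /good; split.
  by move=> /andP[/andP[/and3P[-> -> ->] ->] ->].
by case=> -> -> -> /andP[-> ->].
Qed.

Lemma del_cycle_map (G : sgraph) (S X : {set G}) l (c : seq (del_vertices X)) :
  long_S_cycle (del_set X S) l c ->
  long_S_cycle S l (map val c) /\ [disjoint map val c & X].
Proof.
rewrite /long_S_cycle /S_cycle /is_cycle => /andP[/andP[/and3P[h1 h2 h3] h4] h5]; split.
  rewrite size_map h1 h5 map_inj_uniq ?h3; last exact: val_inj.
  rewrite cycle_map h2 /= andbT; case/hasP: h4 => x xc; rewrite inE => xS.
  by apply/hasP; exists (val x) => //; apply: map_f.
by apply/pred0P=> x /=; apply/negbTE/negP=> /andP[/mapP[y _ ->]]; apply/negP/(valP y).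
Qed.

Import Order.TTheory GRing.Theory Num.Theory.

(** Rounding up adds at most 1, and [1 <= log2 k] because [k] is at least 2. *)
Lemma up_log_le_log2 (R : realType) k : 1 < k ->
  ((up_log 2 k)%:R <= 2 * log2 (k%:R : R) :> R)%R.
Proof.
move=> k1; have /andP[lk _] := up_log_bounds (isT : 1 < 2) k1.
have ln2 : (0 < ln (2 : R))%R by rewrite ln_gt0 // ltr1n.
have k0 : (0 < k%:R :> R)%R by rewrite ltr0n ltnW.
have h1 : (1 <= log2 (k%:R : R))%R.
  by rewrite /log2 ler_pdivlMr // mul1r ler_ln ?posrE // (ler_nat _ 2).
have h2 : (((up_log 2 k).-1)%:R <= log2 (k%:R : R))%R.
  rewrite /log2 ler_pdivlMr // mulr_natl -lnXn ?ltr0n // ler_ln ?posrE ?exprn_gt0 ?ltr0n // ?(ltnW k1) //.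
  by rewrite -natrX ler_nat ltnW.
have h3 : ((up_log 2 k)%:R <= ((up_log 2 k).-1)%:R + 1 :> R)%R.
  by rewrite natr1 ler_nat leqSpred.
by apply: (le_trans h3); rewrite mulr_natl mulr2n lerD.
Qed.

Theorem theorem4 (R : realType) :
  exists c : R, (0 < c)%R /\
  forall (k l : nat) (G : sgraph) (S : {set G}), 0 < k -> 0 < l ->
    (exists C : 'I_k -> seq G,
        (forall i, long_S_cycle S l (C i)) /\
        (forall i j, i != j -> [disjoint C i & C j])) \/
    (exists X : {set G},
        (#|X|%:R <= c * l%:R * (k%:R * log2 (k%:R : R)))%R /\
        ~ exists C : seq (del_vertices X), long_S_cycle (del_set X S) l C).
Proof.
(* Twice the 600 of [sX'] below; the factor 2 comes from [up_log_le_log2]. *)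
exists 1200%R; split; first by rewrite ltr0n.
move=> k l G S k0 l0; have se := @edge_sym G; have ie := @edge_irrefl G.
(* For [k = 1] the logarithm vanishes and the deleted set has to be empty. *)
have [k1|k1] := leqP k 1.
  have -> : k = 1 by apply/eqP; rewrite eqn_leq k1.
  have [[c hc]|none] := EM (exists c, long_S_cycle S l c).
    by left; exists (fun=> c); split=> // i j; rewrite (ord1 i) (ord1 j) eqxx.
  right; exists finset.set0; split.
    by rewrite cards0 /log2 ln1 mul0r !mulr0.
  by case=> c /del_cycle_map[hc _]; apply: none; exists (map val c).
have L0 : (0 < up_log 2 k) by rewrite up_log_gt0.
have kL : (k <= 2 ^ up_log 2 k) by case/andP: (up_log_bounds (isT : (1 < 2)) k1).
case: (long_cycle_packing S se ie l0 (exponent_bound L0 kL)) => [[C [h1 h2]]|[X sX hX]].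
  by left; exists C; split=> // i; apply/long_S_cycleE.
right; exists X; split; last first.
  case=> c /del_cycle_map[/long_S_cycleE hc dc]; by have := hX _ hc; rewrite dc.
(* With [k] at most [A = k * L] and [1 <= l], the bound is at most [(31 * 19 + 6) * A * l], that is
   [595 * A * l]. *)
have sX' : (#|X| <= 600 * l * (k * up_log 2 k)).
  apply: leq_trans sX _; move: L0 l0 k0; move: (up_log 2 k) => L L0 l0 k0.
  have h1 : (k <= k * L) by rewrite leq_pmulr.
  have -> : (2 * (k * (2 * (6 * L) + 3)) + k = 24 * (k * L) + 7 * k) by lia.
  move: h1; move: (k * L) => A h1.
  have h2 : ((24 * A + 7 * k) * (12 * l + 7) <= 31 * A * (19 * l)) by apply: leq_mul; lia.
  have h3 : (k * (4 * l + 2) <= A * (6 * l)) by apply: leq_mul; lia.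
  by move: h2 h3; clear; lia.
apply: (@le_trans _ _ (600 * l%:R * (k%:R * (2 * log2 (k%:R : R))))%R); last by lra.
apply: (@le_trans _ _ (600 * l * (k * up_log 2 k))%:R%R); first by rewrite ler_nat.
rewrite !natrM; apply: ler_wpM2l; first by rewrite mulr_ge0 ?ler0n.
apply: ler_wpM2l; first exact: ler0n.
exact: up_log_le_log2.
Qed.
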